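(* Let $A$ be a commutative Noetherian ring, $\mathfrak{b}$ an ideal of $A$, and $M$ an arbitrary (not necessarily finitely generated) $A$-module. Let $\mathbf{f}=(f_1,f_2,\ldots,f_t,\ldots)$ be an infinite $\mathfrak{b}$-filter-regular sequence on $M$ composed of elements of $\mathfrak{b}$. For each integer $i\ge1$ set $U_i:=\{(f_1^{\alpha_1},\ldots,f_i^{\alpha_i}):\alpha_1,\ldots,\alpha_i\ge0\}$, a triangular subset of $A^i$, and let $C(\mathcal{U}_{\mathbf{f}},M)$ be the complex of modules of generalized fractions $$0\to M\xrightarrow{d^0}U_1^{-1}M\xrightarrow{d^1}\cdots\to U_i^{-i}M\xrightarrow{d^i}U_{i+1}^{-(i+1)}M\to\cdots$$ ($M$ in degree $0$, $U_i^{-i}M$ in degree $i$), where $d^0(m)=m/(1)$ for $m\in M$ and $d^i\bigl(m/(v_1,\ldots,v_i)\bigr)=m/(v_1,\ldots,v_i,1)$ for $i\ge1$, $m\in M$, $(v_1,\ldots,v_i)\in U_i$. Then there are $A$-isomorphisms $H^i(C(\mathcal{U}_{\mathbf{f}},M))\cong H^i_{\mathfrak{b}}(M)$ for all integers $i\ge0$.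
   Context: A sequence $a_1,\ldots,a_n\in A$ is a $\mathfrak{b}$-filter-regular sequence on $M$ if $\operatorname{Supp}\bigl((\sum_{j=1}^{i-1}a_jM:_Ma_i)/\sum_{j=1}^{i-1}a_jM\bigr)\subseteq\{\mathfrak{p}\in\operatorname{Spec}(A):\mathfrak{p}\supseteq\mathfrak{b}\}$ for all $i=1,\ldots,n$. An infinite sequence is $\mathfrak{b}$-filter-regular on $M$ if all its finite initial segments are. $H^i_{\mathfrak{b}}$ is the $i$th local cohomology functor. Generalized fractions: let $D_n(A)$ be the set of lower triangular $n\times n$ matrices over $A$, and $|\mathbf{H}|$ the determinant of $\mathbf{H}$. A triangular subset of $A^n$ is a non-empty $U\subseteq A^n$ such that (a) $(u_1,\ldots,u_n)\in U$ implies $(u_1^{\alpha_1},\ldots,u_n^{\alpha_n})\in U$ for all positive integers $\alpha_i$; (b) for all $\mathbf{u},\mathbf{v}\in U$ there are $\mathbf{w}\in U$ and $\mathbf{H},\mathbf{K}\in D_n(A)$ with $\mathbf{H}\mathbf{u}^T=\mathbf{w}^T=\mathbf{K}\mathbf{v}^T$. Define an equivalence relation on $M\times U$ by $(m,\mathbf{u})\sim(g,\mathbf{v})$ iff there are $\mathbf{w}=(w_1,\ldots,w_n)\in U$ and $\mathbf{H},\mathbf{K}\in D_n(A)$ with $\mathbf{H}\mathbf{u}^T=\mathbf{w}^T=\mathbf{K}\mathbf{v}^T$ and $|\mathbf{H}|m-|\mathbf{K}|g\in\sum_{j=1}^{n-1}w_jM$. The class of $(m,\mathbf{u})$ is written $m/\mathbf{u}$,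 and $U^{-n}M$ is the set of classes, an $A$-module under $m/\mathbf{u}+g/\mathbf{v}=(|\mathbf{H}|m+|\mathbf{K}|g)/\mathbf{w}$ (for any $\mathbf{w}\in U$, $\mathbf{H},\mathbf{K}\in D_n(A)$ with $\mathbf{H}\mathbf{u}^T=\mathbf{w}^T=\mathbf{K}\mathbf{v}^T$) and $a(m/\mathbf{u})=am/\mathbf{u}$. *)

(* Defs.v *)
From HB Require Import structures.
From mathcomp Require Import all_boot all_order all_algebra.
From mathcomp Require Import all_classical.
From mathcomp Require Import ring.

Set Implicit Arguments.
Unset Strict Implicit.
Unset Printing Implicit Defensive.

Import GRing.Theory.
Local Open Scope classical_set_scope.
Local Open Scope ring_scope.
Local Open Scope quotient_scope.

Section Submodules.
Variables (A : comPzRingType) (V : lmodType A).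

Record submodule := Submodule {
  submod_pred :> {pred V};
  submodP : submod_closed submod_pred }.

Fact submodule_subsemimod (S : submodule) : subsemimod_closed (submod_pred S).
Proof. exact: GRing.submod_closed_semi (submodP S). Qed.

HB.instance Definition _ (S : submodule) :=
  GRing.isSubmodClosed.Build A V (submod_pred S) (submodule_subsemimod S).

Variable S : submodule.

Definition submod_type : Type := {x : V | x \in submod_pred S}.
HB.instance Definition _ := SubChoice.on submod_type.
HB.instance Definition _ := [SubChoice_isSubLmodule of submod_type by <:].

Definition quotmod : Type := Quotient.quot (submod_pred S).
HB.instance Definition _ := GRing.Zmodule.on quotmod.
HB.instance Definition _ :=
  EqQuotient.copy quotmod (Quotient.quot (submod_pred S)).

Definition quotmod_pi (x : V) : quotmod := \pi x.

Lemma quotmod_eq x y : (quotmod_pi x == quotmod_pi y) = (x - y \in submod_pred S).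
Proof. by rewrite Quotient.idealrBE. Qed.

Lemma quotmod_piD x y : quotmod_pi (x + y) = quotmod_pi x + quotmod_pi y.
Proof. by rewrite /quotmod_pi !piE. Qed.

Lemma quotmod_surj (q : quotmod) : exists x, quotmod_pi x = q.
Proof. by exists (repr q); rewrite /quotmod_pi reprK. Qed.

Definition quotmod_scale (a : A) (q : quotmod) : quotmod :=
  quotmod_pi (a *: repr q).

Lemma quotmod_scaleE a x : quotmod_scale a (quotmod_pi x) = quotmod_pi (a *: x).
Proof.
apply/eqP; rewrite quotmod_eq -scalerBr rpredZ // -quotmod_eq.
by rewrite /quotmod_pi reprK.
Qed.

Fact quotmod_scaleA a b q :
  quotmod_scale a (quotmod_scale b q) = quotmod_scale (a * b) q.
Proof. by case: (quotmod_surj q) => x <-; rewrite !quotmod_scaleE scalerA. Qed.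

Fact quotmod_scale1 : left_id 1 quotmod_scale.
Proof.
by move=> q; case: (quotmod_surj q) => x <-; rewrite quotmod_scaleE scale1r.
Qed.

Fact quotmod_scaleDr : right_distributive quotmod_scale +%R.
Proof.
move=> a q r; case: (quotmod_surj q) => x <-; case: (quotmod_surj r) => y <-.
by rewrite -quotmod_piD !quotmod_scaleE -quotmod_piD scalerDr.
Qed.

Fact quotmod_scaleDl q : {morph quotmod_scale^~ q : a b / a + b}.
Proof.
move=> a b; case: (quotmod_surj q) => x <-.
by rewrite !quotmod_scaleE -quotmod_piD scalerDl.
Qed.

HB.instance Definition _ := GRing.Zmodule_isLmodule.Build A quotmod
  quotmod_scaleA quotmod_scale1 quotmod_scaleDr quotmod_scaleDl.

End Submodules.

Section MoreSubmodules.
Variables (A : comPzRingType).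

Section Subquot.
Variables (V : lmodType A) (K B : submodule V).

Fact trace_submod_closed :
  submod_closed [pred x : submod_type K | val x \in B].
Proof.
split=> [|a x y]; rewrite !inE ?linear0 ?rpred0 //.
by move=> xB yB; rewrite linearP rpredD ?rpredZ.
Qed.
Definition trace_submod := Submodule trace_submod_closed.

(* K / (K :&: B), which is K / B when B is contained in K *)
Definition subquot : lmodType A := quotmod trace_submod.
End Subquot.

Fact zero_submod_closed (V : lmodType A) : submod_closed [pred x : V | x == 0].
Proof.
split=> [|a x y]; rewrite !inE // => /eqP-> /eqP->.
by rewrite scaler0 addr0.
Qed.
Definition zero_submod V := Submodule (zero_submod_closed V).

Section KerIm.
Variables (U V : lmodType A) (f : {linear U -> V}).

Fact ker_submod_closed : submod_closed [pred x | f x == 0].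
Proof.
split=> [|a x y]; rewrite !inE ?linear0 // linearP => /eqP-> /eqP->.
by rewrite scaler0 addr0.
Qed.
Definition ker_submod := Submodule ker_submod_closed.

Fact im_submod_closed : submod_closed [pred y | `[< exists x, f x = y >]].
Proof.
split=> [|a x y]; rewrite !inE; first by exists 0; rewrite linear0.
move=> [x' <-] [y' <-].
by exists (a *: x' + y'); rewrite linearP.
Qed.
Definition im_submod := Submodule im_submod_closed.
End KerIm.

Section Span.
Variables (M : lmodType A) (I : finType) (P : pred I) (a : I -> A).

Fact sum_submod_closed : submod_closed
  [pred y : M | `[< exists x : I -> M, y = \sum_(i | P i) a i *: x i >]].
Proof.
split=> [|c y z]; rewrite !inE.
  by exists (fun=> 0); rewrite big1 // => i _; rewrite scaler0.
move=> [x ->] [x' ->].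
exists (fun i => c *: x i + x' i); rewrite scaler_sumr -big_split /=.
by apply: eq_bigr => i _; rewrite scalerDr !scalerA mulrC.
Qed.

(* the submodule \sum_(i | P i) a_i M *)
Definition sum_submod := Submodule sum_submod_closed.

Lemma sum_submodP (y : M) :
  reflect (exists x : I -> M, y = \sum_(i | P i) a i *: x i) (y \in sum_submod).
Proof. by apply: (iffP idP); rewrite inE. Qed.
End Span.

Section Colon.
Variables (M : lmodType A) (N : submodule M) (a : A).

Fact colon_submod_closed : submod_closed [pred m | a *: m \in N].
Proof.
split=> [|c x y]; rewrite !inE ?scaler0 ?rpred0 // => xN yN.
by rewrite scalerDr scalerA mulrC -scalerA; apply: rpredD => //; apply: rpredZ.
Qed.
Definition colon_submod := Submodule colon_submod_closed.
End Colon.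

End MoreSubmodules.

Notation ideal A := (submodule [the lmodType A of A^o]).

Definition noetherian (A : comPzRingType) : Prop :=
  forall I : ideal A, exists n (g : 'I_n -> A),
    forall x : A, x \in I <-> exists c : 'I_n -> A, x = \sum_i c i * g i.

Definition prime_ideal (A : comPzRingType) (p : ideal A) : Prop :=
  (1 : A) \notin p /\
  forall x y : A, x * y \in p -> x \in p \/ y \in p.

(* x/s = y/t in the localization of X at p *)
Definition loc_eq (A : comPzRingType) (X : lmodType A) (p : ideal A)
    (xs yt : X * A) : Prop :=
  exists2 u : A, u \notin p & u *: (yt.2 *: xs.1 - xs.2 *: yt.1) = 0.

(* the primes p such that the localization of X at p is nonzero, i.e. contains
   a fraction x/s different from 0/1 *)
Definition supp (A : comPzRingType) (X : lmodType A) (p : ideal A) : Prop :=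
  prime_ideal p /\
  exists x : X, exists2 s : A, s \notin p & ~ loc_eq p (x, s) (0, 1).

Definition filter_regular (A : comPzRingType) (b : ideal A) (M : lmodType A)
    (n : nat) (a : 'I_n -> A) : Prop :=
  forall i : 'I_n,
    let N := sum_submod M (fun j : 'I_n => (j < i)%N) a in
    forall p : ideal A,
      supp (subquot (colon_submod N (a i)) N) p -> {subset b <= p}.

Definition filter_regular_inf (A : comPzRingType) (b : ideal A)
    (M : lmodType A) (f : nat -> A) : Prop :=
  forall n : nat, filter_regular b M (fun j : 'I_n => f j).

Record cochain_complex (A : comPzRingType) := Complex {
  cobj :> nat -> lmodType A;
  cdiff : forall i, {linear cobj i -> cobj i.+1};
  cdiffK : forall i x, cdiff i.+1 (cdiff i x) = 0 }.

Definition boundaries (A : comPzRingType) (C : cochain_complex A) (i : nat) :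
    submodule (C i) :=
  match i return submodule (C i) with
  | 0%N => zero_submod (C 0%N)
  | j.+1 => im_submod (cdiff C j)
  end.

Definition cohomology (A : comPzRingType) (C : cochain_complex A) (i : nat) :
    lmodType A :=
  subquot (ker_submod (cdiff C i)) (boundaries C i).

Definition isomorphic (A : comPzRingType) (X Y : lmodType A) : Prop :=
  exists f : {linear X -> Y}, bijective f.

Definition injective_module (A : comPzRingType) (E : lmodType A) : Prop :=
  forall (X Y : lmodType A) (f : {linear X -> Y}) (g : {linear X -> E}),
    injective f -> exists h : {linear Y -> E}, forall x, h (f x) = g x.

Record injective_resolution (A : comPzRingType) (M : lmodType A) :=
  InjectiveResolution {
    res_complex :> cochain_complex A;
    res_aug : {linear M -> res_complex 0%N};
    res_inj : forall i, injective_module (res_complex i);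
    res_aug_inj : injective res_aug;
    res_exact0 : forall x,
      cdiff res_complex 0%N x = 0 <-> exists m, res_aug m = x;
    res_exact : forall i x,
      cdiff res_complex i.+1 x = 0 <-> exists y, cdiff res_complex i y = x }.

Section Torsion.
Variables (A : comPzRingType) (b : ideal A).

Definition ideal_mul (I J : set A) : set A :=
  [set x | exists n (y z : 'I_n -> A),
    (forall k, I (y k) /\ J (z k)) /\ x = \sum_k y k * z k].

Definition ideal_exp (n : nat) : set A :=
  iter n (ideal_mul [set x : A | x \in b]) setT.

Lemma ideal_exp_ideal n : ideal_exp n 0 /\
  forall a x y, ideal_exp n x -> ideal_exp n y -> ideal_exp n (a * x + y).
Proof.
case: n => [|n]; first by [].
split; first by exists 0%N, (fun=> 0), (fun=> 0); split; [case | rewrite big_ord0].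
move=> a x y [n1 [y1 [z1 [h1 ->]]]] [n2 [y2 [z2 [h2 ->]]]].
exists (n1 + n2)%N,
  (fun k => match fintype.split k with inl i => a * y1 i | inr i => y2 i end),
  (fun k => match fintype.split k with inl i => z1 i | inr i => z2 i end).
split=> [k|].
  case: (fintype.split k) => i; last exact: h2.
  by case: (h1 i) => yb zb; split=> //; apply: (@rpredZ A _ b).
rewrite big_split_ord /= mulr_sumr; congr (_ + _); apply: eq_bigr => i _.
  by rewrite (unsplitK (inl i)) mulrA.
by rewrite (unsplitK (inr i)).
Qed.

Lemma ideal_expS n : ideal_exp n.+1 `<=` ideal_exp n.
Proof.
move=> x [k [y [z [h ->]]]]; have [e0 eP] := ideal_exp_ideal n.
elim/big_rec: _ => // i w _ IH.
by apply: eP => //; case: (h i).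
Qed.

Lemma ideal_exp_le m n : (m <= n)%N -> ideal_exp n `<=` ideal_exp m.
Proof.
elim: n => [|n IHn]; first by rewrite leqn0 => /eqP->.
rewrite leq_eqVlt => /orP[/eqP-> //|]; rewrite ltnS => /IHn.
exact: subset_trans (@ideal_expS n).
Qed.

Variable M : lmodType A.

Fact torsion_submod_closed : submod_closed
  [pred m : M | `[< exists n, forall a, ideal_exp n a -> a *: m = 0 >]].
Proof.
split=> [|c x y]; rewrite !inE.
  by exists 0%N => a _; rewrite scaler0.
move=> [n1 h1] [n2 h2]; exists (maxn n1 n2) => a an.
rewrite scalerDr scalerA mulrC -scalerA h1 ?h2 ?scaler0 ?addr0 //.
  exact: ideal_exp_le (leq_maxr n1 n2) _ an.
exact: ideal_exp_le (leq_maxl n1 n2) _ an.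
Qed.

(* Gamma_b(M), the union over n of (0 :_M b^n) *)
Definition torsion : submodule M := Submodule torsion_submod_closed.
End Torsion.

Section TorsionFunctor.
Variables (A : comPzRingType) (b : ideal A).

Section Map.
Variables (X Y : lmodType A) (f : {linear X -> Y}).

Fact torsion_map_proof (x : submod_type (torsion b X)) :
  f (val x) \in submod_pred (torsion b Y).
Proof.
case: x => x /=; rewrite !inE => -[n xn].
by exists n => a /xn; rewrite -linearZ => ->; rewrite linear0.
Qed.

Definition torsion_map (x : submod_type (torsion b X)) :
    submod_type (torsion b Y) := Sub (f (val x)) (torsion_map_proof x).

Fact torsion_map_linear : linear torsion_map.
Proof.
move=> a x y; apply: val_inj; rewrite linearP.
by rewrite -[LHS]/(f (val (a *: x + y))) !linearP.
Qed.

HB.instance Definition _ :=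
  GRing.isLinear.Build A _ _ _ torsion_map torsion_map_linear.
End Map.

Fact torsion_complex_proof (C : cochain_complex A) i x :
  torsion_map (cdiff C i.+1) (torsion_map (cdiff C i) x) = 0.
Proof. by apply: val_inj; rewrite /= cdiffK. Qed.

Definition torsion_complex (C : cochain_complex A) : cochain_complex A :=
  @Complex A (fun i => submod_type (torsion b (C i)))
    (fun i => torsion_map (cdiff C i)) (@torsion_complex_proof C).
End TorsionFunctor.

(* H^i_b(M), the i-th right derived functor of Gamma_b at M, computed with the
   injective resolution E of M: H^i of the complex Gamma_b(E) *)
Definition local_cohomology (A : comPzRingType) (b : ideal A) (M : lmodType A)
    (E : injective_resolution M) (i : nat) : lmodType A :=
  cohomology (torsion_complex b E) i.

(* H is in D_n(A) and H u^T = w^T *)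
Definition transfers (A : comPzRingType) n (H : 'M[A]_n) (u w : 'rV[A]_n) : Prop :=
  is_trig_mx H /\ H *m u^T = w^T.

Record triangular (A : comPzRingType) (n : nat) := Triangular {
  tri_set :> set 'rV[A]_n;
  tri_nonempty : tri_set !=set0;
  tri_pow : forall (u : 'rV[A]_n) (alpha : 'I_n -> nat),
    (forall j, 0 < alpha j)%N -> tri_set u ->
    tri_set (\row_j u 0 j ^+ alpha j);
  tri_common : forall u v : 'rV[A]_n, tri_set u -> tri_set v ->
    exists (w : 'rV[A]_n) (H K : 'M[A]_n),
      [/\ tri_set w, transfers H u w & transfers K v w] }.

Section Transfers.
Variables (A : comPzRingType) (n : nat).
Implicit Types (H K : 'M[A]_n) (u v w : 'rV[A]_n).

Lemma trig_mulmx H K : is_trig_mx H -> is_trig_mx K -> is_trig_mx (H *m K).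
Proof.
move=> /is_trig_mxP h /is_trig_mxP k; apply/is_trig_mxP => i j ij.
rewrite mxE big1 // => l _; case: (ltnP i l) => il; first by rewrite h ?mul0r.
by rewrite k ?mulr0 // (leq_ltn_trans il).
Qed.

Lemma transfers_comp H K u v w :
  transfers H u v -> transfers K v w -> transfers (K *m H) u w.
Proof.
by move=> [hH eH] [hK eK]; split; [apply: trig_mulmx | rewrite -mulmxA eH].
Qed.

Lemma transfers1 u : transfers 1%:M u u.
Proof. by split; [apply: scalar_mx_is_trig | rewrite mul1mx]. Qed.

Lemma transfers_diag u v : transfers (diag_mx u) v (\row_j (u 0 j * v 0 j)).
Proof.
split; first exact: diag_mx_is_trig.
by apply/matrixP => i j; rewrite mul_diag_mx !mxE !ord1.
Qed.

Lemma transfersE H u w i : transfers H u w ->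
  w 0 i = \sum_(l < n | (l <= i)%N) H i l * u 0 l.
Proof.
move=> [/is_trig_mxP h /matrixP/(_ i 0)]; rewrite !mxE => <-.
rewrite [RHS]big_mkcond; apply: eq_bigr => l _; rewrite mxE.
by case: leqP => // il; rewrite h // mul0r.
Qed.

Lemma transfersE1 H u w i : transfers H u w ->
  w 0 i = H i i * u 0 i + \sum_(l < n | (l < i)%N) H i l * u 0 l.
Proof.
move=> /transfersE->; rewrite (bigD1 i) //=; congr (_ + _).
by apply: eq_bigl => l; rewrite ltn_neqAle andbC.
Qed.

(* the ideals generated by the w_l, resp. the w_l^2, with l < k *)
Local Notation Sp k w :=
  (sum_submod [the lmodType A of A^o] (fun l : 'I_n => (l < k)%N) (fun l => w 0 l)).
Local Notation sq w := (\row_j (w 0 j * w 0 j)).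

Lemma mem_gen k w (l : 'I_n) : (l < k)%N -> (w 0 l : A^o) \in Sp k w.
Proof.
move=> lk; rewrite !inE; exists (fun i => if i == l then 1 else 0).
rewrite (bigD1 l) //= eqxx big1 ?addr0; first exact: esym (mulr1 _).
by move=> i /andP[_ /negPf->]; rewrite scaler0.
Qed.

Lemma genMl k w (a x : A) : (x : A^o) \in Sp k w -> (a * x : A^o) \in Sp k w.
Proof. exact: rpredZ. Qed.

Lemma gen_trans k k' w w' (a : A) :
  (forall l : 'I_n, (l < k)%N -> (a * w 0 l : A^o) \in Sp k' w') ->
  forall x : A, (x : A^o) \in Sp k w -> (a * x : A^o) \in Sp k' w'.
Proof.
move=> h x /sum_submodP[c ->]; rewrite mulr_sumr.
apply: rpred_sum => l lk; rewrite -[_ *: _]/(w 0 l * c l) mulrA mulrC.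
exact: genMl (h l lk).
Qed.

Lemma gen_le k k' w (x : A) : (k <= k')%N ->
  (x : A^o) \in Sp k w -> (x : A^o) \in Sp k' w.
Proof.
move=> kk' xk; rewrite -[x]mul1r; apply: gen_trans xk => l lk.
by rewrite mul1r; apply: mem_gen; apply: leq_trans kk'.
Qed.

Lemma prefix_prod k (F : 'I_n -> A) (kn : (k < n)%N) :
  \prod_(i < n | (i < k.+1)%N) F i =
  F (Ordinal kn) * \prod_(i < n | (i < k)%N) F i.
Proof.
rewrite (bigD1 (Ordinal kn)) //=; congr (_ * _); apply: eq_bigl => i.
by rewrite -(inj_eq val_inj) /= ltnS andbC -ltn_neqAle.
Qed.

Lemma prefix_det H u w k : transfers H u w -> (k <= n)%N ->
  forall j : 'I_n, (j < k)%N ->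
  ((\prod_(i < n | (i < k)%N) H i i) * u 0 j : A^o) \in Sp k w.
Proof.
move=> tH; elim: k => [|k IHk] // kn j; rewrite ltnS leq_eqVlt => jk.
have IH := IHk (ltnW kn); rewrite (prefix_prod _ kn); set k' := Ordinal kn.
case/orP: jk => [/eqP jk|jk]; last first.
  by rewrite -mulrA; apply: genMl; apply: gen_le (IH _ jk).
have -> : j = k' by apply: val_inj.
rewrite mulrAC.
have -> : H k' k' * u 0 k' = w 0 k' - \sum_(l < n | (l < k)%N) H k' l * u 0 l.
  by rewrite (transfersE1 k' tH) addrK.
rewrite mulrC mulrBr; apply: (@rpredB A^o).
  by apply: genMl; apply: mem_gen.
rewrite mulr_sumr; apply: rpred_sum => l lk; rewrite mulrCA; apply: genMl.
exact: gen_le (IH _ lk).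
Qed.

Lemma prefix_det_diff H K u w k : transfers H u w -> transfers K u w ->
  (k <= n)%N ->
  ((\prod_(i < n | (i < k)%N) w 0 i) *
   ((\prod_(i < n | (i < k)%N) H i i) - \prod_(i < n | (i < k)%N) K i i) : A^o)
  \in Sp k.-1 (sq w).
Proof.
move=> tH tK; elim: k => [|k IHk] kn.
  by rewrite !big_pred0 // subrr mulr0; apply: rpred0.
have IH := IHk (ltnW kn); rewrite !(prefix_prod _ kn); set k' := Ordinal kn.
move: IH (prefix_det tK (ltnW kn)).
set W := \prod_(i < n | _) _; set h := \prod_(i < n | _) _.
set c := \prod_(i < n | _) _ => IH hc.
have -> : w 0 k' * W * (H k' k' * h - K k' k' * c) =
  w 0 k' * H k' k' * (W * (h - c)) + W * (c * ((H k' k' - K k' k') * w 0 k')).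
  by ring.
apply: (@rpredD A^o); first by apply: genMl; apply: gen_le IH; apply: leq_pred.
have dS : ((H k' k' - K k' k') * w 0 k' : A^o) \in Sp k u.
  have e : (H k' k' - K k' k') * u 0 k' =
      \sum_(l < n | (l < k)%N) (K k' l - H k' l) * u 0 l.
    have /eqP := transfersE1 k' tK; rewrite (transfersE1 k' tH) => /eqP e.
    rewrite mulrBl; apply/eqP; rewrite subr_eq; apply/eqP.
    under eq_bigr do rewrite mulrBl.
    by rewrite sumrB addrAC [X in X - _]addrC -e addrK.
  rewrite {1}(transfersE1 k' tH) mulrDr mulrCA e.
  apply: (@rpredD A^o); apply: genMl; apply: rpred_sum => l lk;
    by apply: genMl; apply: mem_gen.
have cS : (c * ((H k' k' - K k' k') * w 0 k') : A^o) \in Sp k w.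
  exact: gen_trans dS.
apply: gen_trans cS => l lk.
rewrite /W (bigD1 l) //= mulrC mulrA; rewrite mulrC; apply: genMl.
by have := @mem_gen k (sq w) l lk; rewrite mxE.
Qed.

End Transfers.

Section GenFrac.
Variables (A : comPzRingType) (n : nat) (U : triangular A n) (M : lmodType A).
Implicit Types (H K : 'M[A]_n) (u v w : 'rV[A]_n) (m g : M).

(* \sum_(j=1)^(n-1) w_j M *)
Definition psum w : submodule M :=
  sum_submod M (fun j : 'I_n => (j < n.-1)%N) (fun j => w 0 j).

Definition gf_rel (x y : M * U) : Prop :=
  exists w H K,
    [/\ tri_set U w, transfers H (val x.2) w, transfers K (val y.2) w
      & \det H *: x.1 - \det K *: y.1 \in psum w].

Section Equivalence.
Local Notation Sp k w :=
  (sum_submod [the lmodType A of A^o] (fun l : 'I_n => (l < k)%N) (fun l => w 0 l)).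
Local Notation sq w := (\row_j (w 0 j * w 0 j)).

Lemma scale_gen k w (a : A) m : (a : A^o) \in Sp k w ->
  a *: m \in sum_submod M (fun j : 'I_n => (j < k)%N) (fun j => w 0 j).
Proof.
move=> /sum_submodP[c ->]; rewrite scaler_suml; apply/sum_submodP.
by exists (fun i => c i *: m); apply: eq_bigr => i _; rewrite scalerA.
Qed.

Lemma det_psum H u w m : transfers H u w -> m \in psum u ->
  \det H *: m \in psum w.
Proof.
move=> tH /sum_submodP[x ->]; rewrite scaler_sumr; apply: rpred_sum => j jn.
rewrite scalerA; apply: scale_gen.
rewrite det_trig ?(proj1 tH) // (bigID (fun i : 'I_n => (i < n.-1)%N)) /=.
by rewrite mulrAC mulrC; apply: genMl; apply: prefix_det tH _ _ jn; apply: leq_pred.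
Qed.

Lemma sq_tri w : tri_set U w -> tri_set U (sq w).
Proof.
move=> Uw; have := tri_pow (fun _ : 'I_n => isT : (0 < 2)%N) Uw.
by under eq_mx do rewrite expr2.
Qed.

Lemma det_diff_psum H K u w m : transfers H u w -> transfers K u w ->
  \det (diag_mx w) *: ((\det H - \det K) *: m) \in psum (sq w).
Proof.
move=> tH tK; rewrite scalerA; apply: scale_gen.
have := prefix_det_diff tH tK (leqnn n).
rewrite det_diag (det_trig (proj1 tH)) (det_trig (proj1 tK)).
have e (F : 'I_n -> A) : \prod_(i < n | (i < n)%N) F i = \prod_i F i.
  by apply: eq_bigl => i; rewrite ltn_ord.
by rewrite !e.
Qed.

(* m/w = 0; see frac_eqP *)
Definition vanishes w m : Prop :=
  exists w' R, [/\ tri_set U w', transfers R w w' & \det R *: m \in psum w'].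

Lemma psum_vanishes w m : tri_set U w -> m \in psum w -> vanishes w m.
Proof.
by move=> Uw mw; exists w, 1%:M; rewrite det1 scale1r; split=> //; apply: transfers1.
Qed.

Lemma vanishes_diff H K u w m : tri_set U w -> transfers H u w -> transfers K u w ->
  vanishes w ((\det H - \det K) *: m).
Proof.
move=> Uw tH tK; exists (sq w), (diag_mx w); split; first exact: sq_tri.
  exact: transfers_diag.
exact: det_diff_psum tH tK.
Qed.

Lemma vanishes_inv R w w' m : transfers R w w' ->
  vanishes w' (\det R *: m) -> vanishes w m.
Proof.
move=> tR [w2 [S [Uw2 tS h]]]; exists w2, (S *m R); split=> //.
  exact: transfers_comp tR tS.
by rewrite det_mulmx -scalerA.
Qed.

Lemma vanishesD w m g : vanishes w m -> vanishes w g -> vanishes w (m + g).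
Proof.
move=> [w1 [S [Uw1 tS hS]]] [w2 [T [Uw2 tT hT]]].
have [y [F [G [Uy tF tG]]]] := tri_common Uw1 Uw2.
have tFS := transfers_comp tS tF; have tGT := transfers_comp tT tG.
have tD := transfers_diag y y.
exists (sq y), (diag_mx y *m (F *m S)); split; first exact: sq_tri.
  exact: transfers_comp tFS tD.
rewrite scalerDr; apply: rpredD; rewrite det_mulmx -scalerA.
  apply: det_psum tD _; rewrite det_mulmx -scalerA; exact: det_psum tF hS.
rewrite -[\det (F *m S)](subrK (\det (G *m T))) scalerDl scalerDr.
apply: rpredD; first exact: det_diff_psum tFS tGT.
apply: det_psum tD _; rewrite det_mulmx -scalerA; exact: det_psum tG hT.
Qed.

Lemma vanishesZ w a m : vanishes w m -> vanishes w (a *: m).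
Proof.
move=> [w1 [S [Uw1 tS hS]]]; exists w1, S; split=> //.
by rewrite scalerA mulrC -scalerA rpredZ.
Qed.

Lemma vanishesN w m : vanishes w m -> vanishes w (- m).
Proof. by rewrite -scaleN1r; apply: vanishesZ. Qed.

Lemma vanishesB w m g : vanishes w m -> vanishes w g -> vanishes w (m - g).
Proof. by move=> hm hg; apply: vanishesD => //; apply: vanishesN. Qed.

Lemma vanishes_transfer R w w' m : tri_set U w' -> transfers R w w' ->
  vanishes w m -> vanishes w' (\det R *: m).
Proof.
move=> Uw' tR [w2 [S [Uw2 tS hS]]].
have [y [F [G [Uy tF tG]]]] := tri_common Uw2 Uw'.
apply: (vanishes_inv tG); rewrite scalerA -det_mulmx.
have tFS := transfers_comp tS tF; have tGR := transfers_comp tR tG.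
rewrite -[\det (G *m R)](subrK (\det (F *m S))) scalerDl; apply: vanishesD.
  exact: vanishes_diff tGR tFS.
apply: psum_vanishes => //; rewrite det_mulmx -scalerA; exact: det_psum tF hS.
Qed.

Lemma vanishes_eq H K u w m : tri_set U w -> transfers H u w -> transfers K u w ->
  vanishes w (\det H *: m) -> vanishes w (\det K *: m).
Proof.
move=> Uw tH tK h; rewrite -[\det K](subrK (\det H)) scalerDl.
by apply: vanishesD => //; apply: vanishes_diff tK tH.
Qed.

Lemma gf_relE (x y : M * U) w H K :
  tri_set U w -> transfers H (val x.2) w -> transfers K (val y.2) w ->
  gf_rel x y <-> vanishes w (\det H *: x.1 - \det K *: y.1).
Proof.
move=> Uw tH tK; split; last first.
  move=> [w' [R [Uw' tR h]]]; exists w', (R *m H), (R *m K); split=> //.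
  - exact: transfers_comp tH tR.
  - exact: transfers_comp tK tR.
  - by rewrite !det_mulmx -!scalerA -scalerBr.
move=> [w' [P [Q [Uw' tP tQ h]]]].
have [z [S [T [Uz tS tT]]]] := tri_common Uw Uw'.
apply: (vanishes_inv tS); rewrite scalerBr !scalerA -!det_mulmx.
have tSH := transfers_comp tH tS; have tSK := transfers_comp tK tS.
have tTP := transfers_comp tP tT; have tTQ := transfers_comp tQ tT.
have -> : \det (S *m H) *: x.1 - \det (S *m K) *: y.1 =
    (\det (S *m H) - \det (T *m P)) *: x.1
    - (\det (S *m K) - \det (T *m Q)) *: y.1
    + \det T *: (\det P *: x.1 - \det Q *: y.1).
  rewrite scalerBr !scalerA -!det_mulmx !scalerBl.
  by rewrite opprB [RHS]addrAC !addrA !subrK.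
apply: vanishesD; first apply: vanishesB.
- exact: vanishes_diff tSH tTP.
- exact: vanishes_diff tSK tTQ.
- exact: vanishes_transfer Uz tT (psum_vanishes Uw' h).
Qed.

Lemma tri_common3 (u v t : U) : exists w H K L,
  [/\ tri_set U w, transfers H (val u) w, transfers K (val v) w
    & transfers L (val t) w].
Proof.
have [w [H [K [Uw tH tK]]]] := tri_common (set_valP u) (set_valP v).
have [w' [S [L [Uw' tS tL]]]] := tri_common Uw (set_valP t).
exists w', (S *m H), (S *m K), L; split=> //; exact: transfers_comp tS.
Qed.

Definition gf_relb (x y : M * U) : bool := `[< gf_rel x y >].

Lemma gf_relb_equiv : equiv_class_of gf_relb.
Proof.
have sym x y : gf_rel x y -> gf_rel y x.
  move=> [w [H [K [Uw tH tK h]]]]; exists w, K, H; split=> //.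
  by rewrite -opprB rpredN.
split=> [x|x y|y x z].
- apply/asboolP; exists (val x.2), 1%:M, 1%:M; split; try exact: transfers1.
    exact: set_valP.
  by rewrite subrr rpred0.
- by apply/asboolP/asboolP; apply: sym.
move=> /asboolP xy /asboolP yz; apply/asboolP.
have [w [H [K [L [Uw tH tK tL]]]]] := tri_common3 x.2 y.2 z.2.
apply/(gf_relE Uw tH tL).
have -> : \det H *: x.1 - \det L *: z.1 =
  (\det H *: x.1 - \det K *: y.1) + (\det K *: y.1 - \det L *: z.1).
  by rewrite addrA subrK.
by apply: vanishesD; [apply/(gf_relE Uw tH tK) | apply/(gf_relE Uw tK tL)].
Qed.

Canonical gf_relb_eq := EquivRelPack gf_relb_equiv.
Canonical gf_relb_enc := defaultEncModRel gf_relb.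
End Equivalence.

(* U^{-n}M; fracD and fracZ below give its module structure *)
Definition genfrac : Type := {eq_quot gf_relb}.
HB.instance Definition _ := Choice.on genfrac.
HB.instance Definition _ := EqQuotient.copy genfrac {eq_quot gf_relb}.

(* m/u *)
Definition frac (m : M) (u : U) : genfrac := \pi_genfrac (m, u).

Lemma fracP m (u : U) g (v : U) : frac m u = frac g v <-> gf_rel (m, u) (g, v).
Proof.
split; first by move=> /eqquotP/asboolP.
by move=> h; apply/eqquotP/asboolP.
Qed.

Lemma frac_surj (q : genfrac) : exists m (u : U), q = frac m u.
Proof.
by exists (repr q).1, (repr q).2; rewrite /frac -surjective_pairing reprK.
Qed.

Lemma frac_transfer H m (u w : U) : transfers H (val u) (val w) ->
  frac m u = frac (\det H *: m) w.
Proof.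
move=> tH; apply/fracP.
apply/(@gf_relE (m, u) (_, w) _ _ _ (set_valP w) tH (transfers1 _)).
rewrite det1 scale1r subrr; apply: psum_vanishes; last exact: rpred0.
exact: set_valP.
Qed.

Fact common_den_ex (u v : U) : exists c : U * 'M[A]_n * 'M[A]_n,
  transfers c.1.2 (val u) (val c.1.1) /\ transfers c.2 (val v) (val c.1.1).
Proof.
have [w [H [K [Uw tH tK]]]] := tri_common (set_valP u) (set_valP v).
by exists (exist _ w (mem_set Uw), H, K).
Qed.

Definition common_den (u v : U) : U * 'M[A]_n * 'M[A]_n :=
  projT1 (cid (common_den_ex u v)).

Definition gf_add (q r : genfrac) : genfrac :=
  let: ((m, u), (g, v)) := (repr q, repr r) in
  let: (w, H, K) := common_den u v in
  frac (\det H *: m + \det K *: g) w.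

Definition gf_opp (q : genfrac) : genfrac :=
  let: (m, u) := repr q in frac (- m) u.

Definition gf_scale (a : A) (q : genfrac) : genfrac :=
  let: (m, u) := repr q in frac (a *: m) u.

Fact some_den_ex : exists u : U, True.
Proof. by have [u Uu] := tri_nonempty U; exists (exist _ u (mem_set Uu)). Qed.

Definition gf_zero : genfrac := frac 0 (projT1 (cid some_den_ex)).

Lemma frac_repr q : frac (repr q).1 (repr q).2 = q.
Proof. by rewrite /frac -surjective_pairing reprK. Qed.

Lemma frac_eqP m g H K (u v w : U) :
  transfers H (val u) (val w) -> transfers K (val v) (val w) ->
  frac m u = frac g v <-> vanishes (val w) (\det H *: m - \det K *: g).
Proof.
move=> tH tK; have e := @gf_relE (m, u) (g, v) _ _ _ (set_valP w) tH tK.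
exact: iff_trans (fracP _ _ _ _) e.
Qed.

Lemma frac_eq_same m g (u : U) : frac m u = frac g u <-> vanishes (val u) (m - g).
Proof.
have := @frac_eqP m g _ _ u u u (transfers1 _) (transfers1 _).
by rewrite det1 !scale1r.
Qed.

Lemma tri_common2 (u v : U) : exists (w : U) H K,
  transfers H (val u) (val w) /\ transfers K (val v) (val w).
Proof. by have [[[w H] K] h] := common_den_ex u v; exists w, H, K. Qed.

Lemma gf_addE m g (u v w : U) H K :
  transfers H (val u) (val w) -> transfers K (val v) (val w) ->
  gf_add (frac m u) (frac g v) = frac (\det H *: m + \det K *: g) w.
Proof.
move=> tH tK; rewrite /gf_add.
have := frac_repr (frac m u); have := frac_repr (frac g v).
case: (repr (frac g v)) => g' v'; case: (repr (frac m u)) => m' u' /= ev eu.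
rewrite /common_den; case: cid => -[[w' P] Q] [/= tP tQ].
have [z [S [T [tS tT]]]] := tri_common2 w w'.
have tSH := transfers_comp tH tS; have tTP := transfers_comp tP tT.
have tSK := transfers_comp tK tS; have tTQ := transfers_comp tQ tT.
apply/(frac_eqP _ _ tT tS); rewrite !scalerDr !scalerA -!det_mulmx.
rewrite opprD addrACA; apply: vanishesD.
  by apply/(frac_eqP _ _ tTP tSH).
by apply/(frac_eqP _ _ tTQ tSK).
Qed.

Lemma gf_add_same m g (w : U) : gf_add (frac m w) (frac g w) = frac (m + g) w.
Proof. by rewrite (gf_addE _ _ (transfers1 _) (transfers1 _)) det1 !scale1r. Qed.

Lemma gf_oppE m (u : U) : gf_opp (frac m u) = frac (- m) u.
Proof.
rewrite /gf_opp; have := frac_repr (frac m u).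
case: (repr (frac m u)) => m' u' /= e.
have [w [H [K [tH tK]]]] := tri_common2 u' u.
apply/(frac_eqP _ _ tH tK); rewrite !scalerN -opprD; apply: vanishesN.
by apply/(frac_eqP _ _ tH tK).
Qed.

Lemma gf_scaleE a m (u : U) : gf_scale a (frac m u) = frac (a *: m) u.
Proof.
rewrite /gf_scale; have := frac_repr (frac m u).
case: (repr (frac m u)) => m' u' /= e.
have [w [H [K [tH tK]]]] := tri_common2 u' u.
apply/(frac_eqP _ _ tH tK).
rewrite !scalerA ![_ * a]mulrC -!scalerA -scalerBr; apply: vanishesZ.
by apply/(frac_eqP _ _ tH tK).
Qed.

Lemma frac0 (u v : U) : frac 0 u = frac 0 v.
Proof.
have [w [H [K [tH tK]]]] := tri_common2 u v.
by rewrite (frac_transfer _ tH) (frac_transfer _ tK) !scaler0.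
Qed.

Lemma gf_zeroE (u : U) : gf_zero = frac 0 u.
Proof. exact: frac0. Qed.

Lemma frac_common3 (q r s : genfrac) : exists (w : U) m g h,
  [/\ q = frac m w, r = frac g w & s = frac h w].
Proof.
have [m [u ->]] := frac_surj q; have [g [v ->]] := frac_surj r.
have [h [t ->]] := frac_surj s.
have [w [H [K [L [Uw tH tK tL]]]]] := tri_common3 u v t.
exists (exist _ w (mem_set Uw)), (\det H *: m), (\det K *: g), (\det L *: h).
by split; apply: frac_transfer.
Qed.

Fact gf_addA : associative gf_add.
Proof.
move=> q r s; have [w [m [g [h [-> -> ->]]]]] := frac_common3 q r s.
by rewrite !gf_add_same addrA.
Qed.

Fact gf_addC : commutative gf_add.
Proof.
move=> q r; have [w [m [g [h [-> -> _]]]]] := frac_common3 q r q.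
by rewrite !gf_add_same addrC.
Qed.

Fact gf_add0 : left_id gf_zero gf_add.
Proof.
by move=> q; have [m [u ->]] := frac_surj q; rewrite (gf_zeroE u) gf_add_same add0r.
Qed.

Fact gf_addN : left_inverse gf_zero gf_opp gf_add.
Proof.
move=> q; have [m [u ->]] := frac_surj q.
by rewrite gf_oppE gf_add_same addNr -gf_zeroE.
Qed.

HB.instance Definition _ :=
  GRing.isZmodule.Build genfrac gf_addA gf_addC gf_add0 gf_addN.

Fact gf_scaleA a b q : gf_scale a (gf_scale b q) = gf_scale (a * b) q.
Proof. by have [m [u ->]] := frac_surj q; rewrite !gf_scaleE scalerA. Qed.

Fact gf_scale1 : left_id 1 gf_scale.
Proof. by move=> q; have [m [u ->]] := frac_surj q; rewrite gf_scaleE scale1r. Qed.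

Fact gf_scaleDr : right_distributive gf_scale +%R.
Proof.
move=> a q r; have [w [m [g [h [-> -> _]]]]] := frac_common3 q r q.
by rewrite [LHS](congr1 _ (gf_add_same _ _ _)) !gf_scaleE scalerDr -gf_add_same.
Qed.

Fact gf_scaleDl q : {morph gf_scale^~ q : a b / a + b}.
Proof.
move=> a b; have [m [u ->]] := frac_surj q.
by rewrite !gf_scaleE scalerDl -gf_add_same.
Qed.

HB.instance Definition _ := GRing.Zmodule_isLmodule.Build A genfrac
  gf_scaleA gf_scale1 gf_scaleDr gf_scaleDl.

Lemma fracD m g (u v w : U) H K :
  transfers H (val u) (val w) -> transfers K (val v) (val w) ->
  frac m u + frac g v = frac (\det H *: m + \det K *: g) w.
Proof. exact: gf_addE. Qed.

Lemma fracZ a m (u : U) : a *: frac m u = frac (a *: m) u.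
Proof. exact: gf_scaleE. Qed.

End GenFrac.

Arguments frac {A n U M} m u.

Section AppendOne.
Variables (A : comPzRingType) (n : nat).

(* (v_1, ..., v_n, 1) *)
Definition row1 (v : 'rV[A]_n) : 'rV[A]_n.+1 :=
  \row_j oapp (fun i => v 0 i) 1 (unlift ord_max j).

Lemma row1_lift v (i : 'I_n) : row1 v 0 (lift ord_max i) = v 0 i.
Proof. by rewrite mxE liftK. Qed.

Lemma row1_max v : row1 v 0 ord_max = 1.
Proof. by rewrite mxE unlift_none. Qed.

Lemma bump_max (i : 'I_n) : bump n i = i.
Proof. exact: lift_max. Qed.

Definition mx1 (H : 'M[A]_n) : 'M[A]_n.+1 :=
  \matrix_(i, j) match unlift ord_max i, unlift ord_max j with
                 | Some i', Some j' => H i' j'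
                 | None, None => 1
                 | _, _ => 0
                 end.

Lemma widen_lift_max (i : 'I_n) : widen_ord (leqnSn n) i = lift ord_max i.
Proof. by apply: val_inj; rewrite /= bump_max. Qed.

Lemma transfers_mx1 H u w : transfers H u w -> transfers (mx1 H) (row1 u) (row1 w).
Proof.
move=> [/is_trig_mxP hH eH]; split.
  apply/is_trig_mxP => i j; rewrite mxE.
  case: unliftP => [i' ->|->]; case: unliftP => [j' ->|->] //; rewrite ?ltnn //.
  by rewrite !lift_max; apply: hH.
apply/matrixP => i k; rewrite !mxE ord1 big_ord_recr /=.
under eq_bigr do rewrite widen_lift_max.
rewrite !mxE !unlift_none /=.
case: unliftP => [i' ->|->] /=; last first.
  rewrite big1 ?add0r ?mul1r // => j _.
  by rewrite !mxE unlift_none liftK mul0r.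
rewrite mul0r addr0; move/matrixP/(_ i' 0): eH; rewrite !mxE => <-.
apply: eq_bigr => j _.
by rewrite !mxE !liftK.
Qed.

Lemma det_mx1 H : is_trig_mx H -> \det (mx1 H) = \det H.
Proof.
move=> hH; have [h1 _] : transfers (mx1 H) (row1 0) (row1 (H *m (0 : 'rV_n)^T)^T).
  by apply: transfers_mx1; split; rewrite ?trmxK.
rewrite !det_trig // big_ord_recr /= mxE unlift_none mulr1.
by apply: eq_bigr => i _; rewrite widen_lift_max mxE liftK.
Qed.

End AppendOne.

Section Append.
Variables (A : comPzRingType) (M : lmodType A) (n : nat).
Variables (U : triangular A n) (U' : triangular A n.+1).
Hypothesis UU' : forall u : 'rV[A]_n, tri_set U u -> tri_set U' (row1 u).

Lemma psum_row1 (w : 'rV[A]_n) (y : M) : y \in psum M w -> y \in psum M (row1 w).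
Proof.
case/sum_submodP => x ->; apply: rpred_sum => j jn; apply/sum_submodP.
exists (fun i => if i == lift ord_max j then x j else 0).
rewrite (bigD1 (lift ord_max j)) /=; last by rewrite bump_max.
rewrite eqxx row1_lift big1 ?addr0 // => i /andP[_ /negPf->].
by rewrite scaler0.
Qed.

Definition tri_append (u : U) : U' :=
  exist _ (row1 (val u)) (mem_set (UU' (set_valP u))).

(* m/(v_1, ..., v_n) |-> m/(v_1, ..., v_n, 1); see gf_appendE *)
Definition gf_append (q : genfrac U M) : genfrac U' M :=
  let: (m, u) := repr q in frac m (tri_append u).

Lemma gf_appendE m (u : U) : gf_append (frac m u) = frac m (tri_append u).
Proof.
rewrite /gf_append; have := frac_repr (frac m u : genfrac U M).
case: (repr _) => m' u' /= /fracP[w [H [K [Uw tH tK h]]]].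
apply/fracP; exists (row1 w), (mx1 H), (mx1 K); split=> /=.
- exact: UU'.
- exact: transfers_mx1.
- exact: transfers_mx1.
rewrite !det_mx1 ?(proj1 tH) ?(proj1 tK) //; exact: psum_row1 h.
Qed.

Fact gf_append_linear : linear gf_append.
Proof.
move=> a q r; have [w [m [g [_ [-> -> _]]]]] := frac_common3 q r q.
by rewrite fracZ [_ + _]gf_add_same !gf_appendE fracZ [RHS]gf_add_same.
Qed.

HB.instance Definition _ := GRing.isLinear.Build A _ _ _ gf_append gf_append_linear.

End Append.

Lemma frac_vanish (A : comPzRingType) (M : lmodType A) n (U : triangular A n)
    (m : M) (u : U) (j : 'I_n) :
  (j < n.-1)%N -> val u 0 j = 1 -> frac m u = 0.
Proof.
move=> jn uj; have -> : 0 = frac 0 u :> genfrac U M by exact: gf_zeroE.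
apply/frac_eq_same; rewrite subr0; apply: psum_vanishes; first exact: set_valP.
apply/sum_submodP; exists (fun i => if i == j then m else 0).
rewrite (bigD1 j) //= eqxx uj scale1r big1 ?addr0 // => i /andP[_ /negPf->].
by rewrite scaler0.
Qed.

Section PowerComplex.
Variables (A : comPzRingType) (f : nat -> A).

(* {(f_1^alpha_1, ..., f_i^alpha_i)}, where f_1, f_2, ... are f 0, f 1, ... *)
Definition powers (i : nat) : set 'rV[A]_i :=
  [set u | exists alpha : 'I_i -> nat, u = \row_j f j ^+ alpha j].
Arguments powers i u : clear implicits.

Fact powers_nonempty i : powers i !=set0.
Proof. by exists (\row_j f j ^+ 0), (fun=> 0%N). Qed.

Fact powers_pow i (u : 'rV[A]_i) (alpha : 'I_i -> nat) :
  (forall j, 0 < alpha j)%N -> powers i u -> powers i (\row_j u 0 j ^+ alpha j).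
Proof.
move=> _ [beta ->]; exists (fun j => (beta j * alpha j)%N).
by apply/rowP => j; rewrite !mxE exprM.
Qed.

Fact powers_common i (u v : 'rV[A]_i) : powers i u -> powers i v ->
  exists (w : 'rV[A]_i) (H K : 'M[A]_i),
    [/\ powers i w, transfers H u w & transfers K v w].
Proof.
move=> [alpha ->] [beta ->].
exists (\row_j f j ^+ (alpha j + beta j)), (diag_mx (\row_j f j ^+ beta j)),
  (diag_mx (\row_j f j ^+ alpha j)); split.
- by exists (fun j => (alpha j + beta j)%N).
- have -> : \row_j f j ^+ (alpha j + beta j) =
    \row_j ((\row_j f j ^+ beta j) 0 j * (\row_j f j ^+ alpha j) 0 j) :> 'rV[A]_i.
    by apply/rowP => j; rewrite !mxE exprD mulrC.
  exact: transfers_diag.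
- have -> : \row_j f j ^+ (alpha j + beta j) =
    \row_j ((\row_j f j ^+ alpha j) 0 j * (\row_j f j ^+ beta j) 0 j) :> 'rV[A]_i.
    by apply/rowP => j; rewrite !mxE exprD.
  exact: transfers_diag.
Qed.

Definition power_tri (i : nat) : triangular A i :=
  Triangular (powers_nonempty i) (@powers_pow i) (@powers_common i).

Fact power_tri_append i (u : 'rV[A]_i) :
  tri_set (power_tri i) u -> tri_set (power_tri i.+1) (row1 u).
Proof.
move=> [alpha ->]; exists (fun j => oapp alpha 0%N (unlift ord_max j)).
apply/rowP => j; rewrite !mxE; case: unliftP => [j' ->|->] /=.
  by rewrite mxE bump_max.
by rewrite expr0.
Qed.

Fact power_tri_one : tri_set (power_tri 1) (const_mx 1).
Proof. by exists (fun=> 0%N); apply/rowP => j; rewrite !mxE expr0. Qed.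

Variable M : lmodType A.

Definition gf_obj (i : nat) : lmodType A :=
  match i with
  | 0%N => M
  | j.+1 => genfrac (power_tri j.+1) M
  end.

Definition gf_d0 (m : M) : genfrac (power_tri 1) M :=
  frac m (exist _ (const_mx 1) (mem_set power_tri_one)).

Fact gf_d0_linear : linear gf_d0.
Proof. by move=> a m g; rewrite /gf_d0 fracZ [RHS]gf_add_same. Qed.

HB.instance Definition _ := GRing.isLinear.Build A _ _ _ gf_d0 gf_d0_linear.

Definition gf_diff (i : nat) : {linear gf_obj i -> gf_obj i.+1} :=
  match i return {linear gf_obj i -> gf_obj i.+1} with
  | 0%N => gf_d0
  | j.+1 => gf_append (M := M) (@power_tri_append j.+1)
  end.

Fact gf_diffK i x : gf_diff i.+1 (gf_diff i x) = 0.
Proof.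
case: i x => [|i] x /=.
  rewrite /gf_d0 gf_appendE.
  apply: (@frac_vanish _ _ _ _ _ _ ord0) => //=; rewrite mxE.
  by case: unliftP => [j' _|] //=; rewrite mxE.
have [m [u ->]] := frac_surj x; rewrite !gf_appendE.
apply: (@frac_vanish _ _ _ _ _ _ (lift ord_max ord_max)).
  by rewrite lift_max.
by rewrite /= row1_lift row1_max.
Qed.

Definition genfrac_complex : cochain_complex A := Complex gf_diffK.
End PowerComplex.

(* Main.v *)
(* Write Gamma for Gamma_b, C for the complex of generalized fractions and E for
   the injective resolution of M. Two facts about C are needed:
   - f_(i+1) acts bijectively on C^(i+1) (it may be absorbed in the last entry of
     the denominator), so C^(i+1) has no local cohomology;
   - the cohomology of C is b-torsion, because powers of a filter-regular sequence
     are filter-regular.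
   Since the cohomology of C is b-torsion while E / Gamma E consists of torsion-free
   injective modules, the composite C -> M -> E -> E / Gamma E is null-homotopic;
   correcting by a homotopy s yields a chain map C -> Gamma E. Its being a
   quasi-isomorphism amounts to the exactness of the mapping cone of
   s : C^(>=1) -> E / Gamma E. The cohomology of this cone is b-torsion, and its
   terms have exact Koszul complexes with respect to b; the latter property passes
   to cokernels and forbids b-torsion, so the cone is exact degree by degree. *)

From HB Require Import structures.
From mathcomp Require Import all_boot all_order all_algebra.
From mathcomp Require Import all_classical.
From mathcomp Require Import ring.
Require Import Defs.

Set Implicit Arguments.
Unset Strict Implicit.
Unset Printing Implicit Defensive.

Import GRing.Theory.
Local Open Scope ring_scope.

(** * Submodules, torsion and injective modules over a noetherian ring *)

Section Submodules.
Variables (A : comPzRingType) (V : lmodType A).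

Lemma submodule_lin (N : submodule V) (a : A) (x y : V) :
  x \in N -> y \in N -> a *: x + y \in N.
Proof. by move=> xN yN; rewrite rpredD ?rpredZ. Qed.

Lemma zero_submodP (x : V) : (x \in zero_submod V) = (x == 0).
Proof. by rewrite inE. Qed.

Lemma scale_exp_le (N : submodule V) (a : A) (x : V) m n :
  (m <= n)%N -> a ^+ m *: x \in N -> a ^+ n *: x \in N.
Proof. by move=> mn h; rewrite -(subnK mn) exprD -scalerA rpredZ. Qed.

(** Zorn's lemma, used twice: with the powers of an element as [Q] it yields primes, with the
    nonzero torsion elements it yields a maximal submodule meeting the torsion in 0. *)
Lemma maximal_submodule (Q : V -> Prop) (G0 : submodule V) :
  (forall x, x \in G0 -> ~ Q x) ->
  exists G : submodule V, [/\ {subset G0 <= G}, forall x, x \in G -> ~ Q x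
    & forall x, x \notin G -> exists a y, y \in G /\ Q (a *: x + y)].
Proof.
move=> hG0.
(* [S] must contain [G0] only if it is nonempty, because the union of the empty chain has to satisfy
   [P] too. *)
pose P (S : set V) := [/\ forall a x y, S x -> S y -> S (a *: x + y),
  forall x, S x -> ~ Q x & forall x, S x -> forall z, z \in G0 -> S z].
have [F FP tF|S [[Slin SQ S0] Smax]] := @Zorn_bigcup V P.
  split=> [a x y [X FX Xx] [Y FY Yy]|x [X FX Xx]|x [X FX Xx] z zG].
  - have [XY|YX] := tF _ _ FX FY.
      by exists Y => //; case: (FP _ FY) => h _ _; apply: h => //; apply: XY.
    by exists X => //; case: (FP _ FX) => h _ _; apply: h => //; apply: YX.
  - by case: (FP _ FX) => _ h _; apply: h.
  - by exists X => //; case: (FP _ FX) => _ _ h; apply: h Xx _ zG.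
have Smax' (T : set V) : P T -> (S `<=` T)%classic -> (T `<=` S)%classic.
  by move=> PT ST; apply: contrapT => TS; apply: (Smax T) => //; split.
have [[x0 Sx0]|Semp] := pselect (exists x, S x); last first.
  exfalso; apply: (Semp); exists 0; apply: (Smax' [set x | x \in G0]%classic).
  - split=> //; first by move=> a x y; apply: submodule_lin.
  - by move=> x Sx; case: (Semp); exists x.
  - exact: rpred0.
have S0' := S0 _ Sx0.
have S00 : S 0 by apply: S0'; apply: rpred0.
have cS : submod_closed [pred x | `[< S x >]].
  by split=> [|a x y]; rewrite !inE //; apply: Slin.
exists (Submodule cS); split=> [x /S0' Sx|x|x].
- by rewrite inE.
- by rewrite inE; apply: SQ.
move=> xS; apply: contrapT => hx.
have : ~ S x by move: xS; rewrite inE => /asboolPn.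
(* If the claim failed, S + A x would still avoid [Q], so by maximality x would lie in S. *)
apply; apply: (Smax' [set z | exists a y, S y /\ z = a *: x + y]%classic).
- split.
  + move=> c _ _ [a [y [Sy ->]]] [a' [y' [Sy' ->]]].
    exists (c * a + a'), (c *: y + y'); split; first exact: Slin.
    by rewrite scalerDr scalerDl scalerA addrACA.
  + move=> _ [a [y [Sy ->]]] Qz; apply: hx; exists a, y; split=> //.
    by rewrite inE.
  + move=> _ _ z zG; exists 0, z; split; first exact: S0'.
    by rewrite scale0r add0r.
- by move=> y Sy; exists 0, y; rewrite scale0r add0r.
- by exists 1, 0; rewrite scale1r addr0.
Qed.

Fact quotmod_pi_linear (N : submodule V) : linear (quotmod_pi N).
Proof. by move=> a x y; rewrite quotmod_piD -quotmod_scaleE. Qed.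

HB.instance Definition _ (N : submodule V) :=
  GRing.isLinear.Build A V (quotmod N) *:%R (quotmod_pi N) (quotmod_pi_linear N).

End Submodules.

Section Noetherian.
Variable A : comPzRingType.

Definition gens (b : ideal A) n (g : 'I_n -> A) : Prop :=
  forall x : A, x \in b <-> exists c : 'I_n -> A, x = \sum_i c i * g i.

Lemma gens_mem (b : ideal A) n (g : 'I_n -> A) i : gens b g -> (g i : A^o) \in b.
Proof.
move=> hg; apply/hg; exists (fun j => if j == i then 1 else 0).
rewrite (bigD1 i) //= eqxx mul1r big1 ?addr0 // => j /negPf->.
by rewrite mul0r.
Qed.

Lemma ideal_chain_stable (hA : noetherian A) (J : nat -> ideal A) :
  (forall n, {subset J n <= J n.+1}) ->
  exists n, forall k, {subset J k <= J n}.
Proof.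
move=> JS.
have Jle m n : (m <= n)%N -> {subset J m <= J n}.
  elim: n => [|n IH]; first by rewrite leqn0 => /eqP->.
  rewrite leq_eqVlt => /orP[/eqP-> //|/IH h x xJ]; apply: JS; exact: h.
have cU : submod_closed [pred a : A^o | `[< exists n, a \in J n >]].
  split=> [|a x y]; rewrite !inE; first by exists 0%N; apply: rpred0.
  move=> [m xm] [n yn]; exists (maxn m n); apply: submodule_lin.
    exact: Jle (leq_maxl m n) _ xm.
  exact: Jle (leq_maxr m n) _ yn.
have [r [g hg]] := hA (Submodule cU).
have hn (i : 'I_r) : exists n, (g i : A^o) \in J n.
  by have := gens_mem i hg; rewrite inE.
have [n nP] := choice hn.
exists (\max_i n i) => k x xk.
have [|c ->] := (hg x).1; first by rewrite inE; exists k.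
apply: (@rpred_sum A^o) => i _; apply: (@rpredZ A A^o).
by apply: Jle (nP i); apply: leq_bigmax.
Qed.

(** An ideal maximal among those containing [J] and missing the powers of [g] is prime: otherwise p
    + A x and p + A y both contain powers of [g], whose product lies in p. *)
Lemma prime_avoiding (J : ideal A) (g : A) :
  (forall n, (g ^+ n : A^o) \notin J) ->
  exists p : ideal A, [/\ prime_ideal p, {subset J <= p} & g \notin p].
Proof.
move=> gJ.
have [|p [Jp pg pmax]] := @maximal_submodule A A^o (fun a => exists n, a = g ^+ n) J.
  by move=> x xJ [n e]; move: (gJ n); rewrite -e xJ.
exists p; split=> //; last first.
  by apply/negP => gp; apply: (pg g gp); exists 1%N; rewrite expr1.
split; first by apply/negP => p1; apply: (pg 1 p1); exists 0%N; rewrite expr0.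
move=> x y xy; apply: contrapT => h.
have [xp|xp] := boolP ((x : A^o) \in p); first by apply: h; left.
have [yp|yp] := boolP ((y : A^o) \in p); first by apply: h; right.
have [a [z [zp [n en]]]] := pmax x xp; have [c [t [tp [m em]]]] := pmax y yp.
apply: (pg (g ^+ n * g ^+ m)); last by exists (n + m)%N; rewrite exprD.
rewrite -en -em.
have -> : (a *: (x : A^o) + z) * (c *: (y : A^o) + t) =
  (a * c) *: (x * y : A^o) + ((a * x + z) *: t + (c * y) *: z) :> A^o.
  rewrite /GRing.scale /=; ring.
by apply: submodule_lin => //; apply: submodule_lin => //; apply: rpredZ.
Qed.

End Noetherian.

Section Torsion.
Variables (A : comPzRingType) (b : ideal A).

(** Induction on the sum of the exponents: multiplying x by g_i lowers the i-th one. This reduces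
    claims about elements nilpotent modulo [K] to the single step by all the g_i. *)
Lemma gens_nilpotent_ind (V : lmodType A) (r : nat) (g : 'I_r -> A)
    (K : submodule V) (Q : V -> Prop) :
  (forall x, x \in K -> Q x) -> (forall x, (forall i, Q (g i *: x)) -> Q x) ->
  forall x, (forall i, exists n, g i ^+ n *: x \in K) -> Q x.
Proof.
move=> KQ Qg x /choice[n hn].
elim: {n}(\sum_i n i)%N {-2}n (leqnn (\sum_i n i)) x hn => [|s IH] n ns x hn.
  (* Going through [Qg] also covers r = 0, where no index shows that x is in [K]. *)
  apply: Qg => i; apply: KQ; apply: rpredZ; have := hn i.
  suff -> : n i = 0%N by rewrite expr0 scale1r.
  by move: ns; rewrite leqn0 sum_nat_eq0 => /forallP/(_ i)/eqP.
have [[i ni]|n0] := pselect (exists i, n i = 0%N).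
  by apply: KQ; have := hn i; rewrite ni expr0 scale1r.
apply: Qg => i; apply: (IH (fun j => if j == i then (n i).-1 else n j)).
  have ni : (0 < n i)%N by rewrite lt0n; apply/eqP => e; apply: n0; exists i.
  move: ns; rewrite (bigD1 i) //= [X in _ -> (X <= _)%N](bigD1 i) //= eqxx.
  have -> : (\sum_(j < r | j != i) (if j == i then (n i).-1 else n j) =
            \sum_(j < r | j != i) n j)%N by apply: eq_bigr => j /negPf->.
  by case: (n i) ni.
move=> j; case: eqP => [->|_]; last first.
  by rewrite scalerA mulrC -scalerA rpredZ.
rewrite scalerA -exprSr; apply: scale_exp_le (hn i); exact: leqSpred.
Qed.

(** Finite generation of b turns separate exponents for its elements into one power of b. *)
Lemma torsionP (hA : noetherian A) (X : lmodType A) (x : X) :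
  x \in torsion b X <-> forall g : A, (g : A^o) \in b -> exists n, g ^+ n *: x = 0.
Proof.
split; first rewrite inE => -[n xn] g gb.
  exists n; apply: xn; elim: n => [|n IH] //=.
  exists 1%N, (fun=> g), (fun=> g ^+ n); split=> //.
  by rewrite big_ord1 exprS.
move=> hx; have [r [g hg]] := hA b.
apply: (@gens_nilpotent_ind X r g (zero_submod X) (fun x => x \in torsion b X)).
- by move=> y; rewrite zero_submodP => /eqP->; apply: rpred0.
- move=> y hy.
  have hn i : exists n, forall a, ideal_exp b n a -> a *: (g i *: y) = 0.
    by have := hy i; rewrite inE.
  have [n nP] := choice hn.
  rewrite inE; exists (\max_i n i).+1 => a [k [u [v [uv ->]]]].
  rewrite scaler_suml big1 // => j _; have [/= ub vb] := uv j.
  have [c ->] := (hg (u j)).1 ub; rewrite mulrC mulr_sumr scaler_suml big1 // => i _.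
  rewrite mulrA -scalerA mulrC -scalerA (nP i) ?scaler0 //.
  by apply: ideal_exp_le vb; apply: leq_bigmax.
- move=> i; have [n e] := hx _ (gens_mem i hg); exists n.
  by rewrite zero_submodP e.
Qed.

Lemma torsion_scale (hA : noetherian A) (X : lmodType A) (x : X) :
  (forall g : A, (g : A^o) \in b -> exists n, g ^+ n *: x \in torsion b X) ->
  x \in torsion b X.
Proof.
move=> h; apply/(torsionP hA) => g gb.
have [n /(torsionP hA)/(_ g gb)[m e]] := h g gb.
by exists (m + n)%N; rewrite exprD -scalerA.
Qed.

End Torsion.

Section Injective.
Variable A : comPzRingType.

(** Since [phi] kills ker p it descends to im p, and injectivity extends it from there to Y. *)
Lemma injective_factor (E : lmodType A) (hE : injective_module E)
    (P Y : lmodType A) (p : {linear P -> Y}) (phi : {linear P -> E}) :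
  (forall x, p x = 0 -> phi x = 0) ->
  exists psi : {linear Y -> E}, forall x, psi (p x) = phi x.
Proof.
move=> hp.
pose I := submod_type (im_submod p).
have sP (y : I) : exists x, p x = val y.
  by have := valP y; rewrite inE.
have [s hs] := choice sP.
pose ph (y : I) := phi (s y).
have phE (y : I) x : p x = val y -> ph y = phi x.
  move=> e; apply/eqP; rewrite -subr_eq0 -linearB; apply/eqP; apply: hp.
  by rewrite linearB hs e subrr.
have ph_lin : linear ph.
  move=> a x y; rewrite -linearP; apply: phE.
  by rewrite !linearP !hs.
pose phl : {linear I -> E} :=
  HB.pack ph (GRing.isLinear.Build A I E _ ph ph_lin).
pose vl : {linear I -> Y} := val.
have [h hh] := hE I Y vl phl val_inj.
exists h => x.
have xI : p x \in submod_pred (im_submod p) by rewrite inE; exists x.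
have := hh (Sub (p x) xI); rewrite /vl /= => ->.
exact: phE.
Qed.

End Injective.

Section Retraction.
Variables (A : comPzRingType) (hA : noetherian A) (b : ideal A).
Variables (E : lmodType A) (hE : injective_module E).

(** Let G be maximal among the submodules meeting Gamma E in 0. Then E / G is torsion and contains a
    copy of Gamma E; by injectivity the inclusion of Gamma E in E extends to E / G. So Gamma E is a
    direct summand of E. *)
Lemma torsion_retraction : exists r : {linear E -> E},
  (forall x, r x \in torsion b E) /\ (forall x, x \in torsion b E -> r x = x).
Proof.
have [|G [_ GT Gmax]] :=
  @maximal_submodule A E (fun x => x \in torsion b E /\ x <> 0) (zero_submod E).
  by move=> x; rewrite zero_submodP => /eqP-> [].
have GT0 x : x \in G -> x \in torsion b E -> x = 0.
  by move=> xG xT; apply: contrapT => x0; apply: (GT x).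
(* E / G is torsion: the ideals (G : g^n x) stabilize. If g^n x is not in G, some a g^n x + y with y
   in G is nonzero and torsion. A power g^k kills it, so a g^(n+k) x is in G, hence so is a g^n x by
   stability, a contradiction. *)
have mG x (g : A) : (g : A^o) \in b -> exists n, g ^+ n *: x \in G.
  move=> gb.
  have cJ n : submod_closed [pred a : A^o | (a : A) *: (g ^+ n *: x) \in G].
    split=> [|a y z]; rewrite !inE ?scale0r ?rpred0 // => yG zG.
    by rewrite scalerDl -scalerA submodule_lin.
  have [n a|n nP] := @ideal_chain_stable A hA (fun n => Submodule (cJ n)).
    by rewrite !inE => h; rewrite exprS -scalerA scalerA mulrC -scalerA rpredZ.
  exists n; apply: contrapT => /negP/Gmax[a [y [yG [tT t0]]]].
  have aG : a *: (g ^+ n *: x) \notin G.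
    apply/negP => aG; apply: t0; apply: GT0 tT; exact: rpredD.
  have [k] := (torsionP b hA _).1 tT g gb; rewrite scalerDr => /eqP.
  rewrite addr_eq0 => /eqP e; case/negP: aG.
  have := nP (n + k)%N a; rewrite !inE; apply.
  rewrite addnC exprD -scalerA scalerA mulrC -scalerA e.
  by rewrite rpredN rpredZ.
pose pil : {linear E -> quotmod G} := quotmod_pi G.
pose T := submod_type (torsion b E).
pose vl : {linear T -> E} := val.
have pi0 x : x \in G -> pil x = 0.
  move=> xG; rewrite -(linear0 pil); apply/eqP.
  by rewrite /= quotmod_eq subr0.
have inj_i : injective (pil \o vl).
  move=> x y /= /eqP; rewrite quotmod_eq -[val x - val y]/(vl x - vl y) -linearB => h.
  have /eqP := GT0 _ h (valP (x - y)).
  by rewrite (linearB vl) subr_eq0 => /eqP/val_inj.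
have [h hh] := hE (f := pil \o vl) vl inj_i.
exists (h \o pil); split=> x /=; last first.
  by move=> xT; have := hh (Sub x xT).
apply/(torsionP b hA) => g gb; have [n ng] := mG x g gb; exists n.
by rewrite -linearZ -(linearZ_LR pil) pi0 // linear0.
Qed.

End Retraction.

(** * The Koszul complex *)

Section Koszul.
Variable A : comPzRingType.

(* D is the differential of the total, ungraded Koszul complex of generators of b,
   acting on A^N; j0 is the coordinate of degree 0. *)
Definition koszul_mx (b : ideal A) N (D : 'M[A]_N) (j0 : 'I_N) : Prop :=
  [/\ D *m D = 0, forall j, D j0 j = 0, forall i, (D i j0 : A^o) \in b
    & forall f : A, (f : A^o) \in b -> exists H, D *m H + H *m D = f%:M].

(** Generators are added one at a time, by the cone of multiplication by g on the complex built so
    far; N doubles each time. *)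
Lemma koszul_seq (b : ideal A) (s : seq A) :
  (forall g : A, g \in s -> (g : A^o) \in b) ->
  exists N (D : 'M[A]_N) (j0 : 'I_N),
  [/\ D *m D = 0, forall j, D j0 j = 0, forall i, (D i j0 : A^o) \in b
    & forall g : A, g \in s -> exists H, D *m H + H *m D = g%:M].
Proof.
elim: s => [|g s IH] sb.
  exists 1%N, 0, ord0; split=> [|j|i|//]; rewrite ?mulmx0 ?mxE //.
  exact: (@rpred0 A^o).
have [|N [D [j0 [DD D0 Db DH]]]] := IH.
  by move=> x xs; apply: sb; rewrite inE xs orbT.
exists (N + N)%N, (block_mx D 0 g%:M (- D)), (lshift N j0); split.
- rewrite mulmx_block !(mulmx0, mul0mx, DD, addr0, add0r, mulmxN, mulNmx, opprK).
  by rewrite mul_scalar_mx mul_mx_scalar subrr block_mx0.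
- move=> j; rewrite -(splitK j); case: (fintype.split j) => k /=.
    by rewrite block_mxEul.
  by rewrite block_mxEur mxE.
- move=> i; rewrite -(splitK i); case: (fintype.split i) => k /=.
    by rewrite block_mxEul.
  rewrite block_mxEdl mxE; apply: (@rpredMn A^o); apply: sb; exact: mem_head.
- move=> x; rewrite inE => /orP[/eqP->|/DH[H eH]].
    (* The identity between the two copies is a homotopy for the new generator; an old homotopy acts
       on both copies, with a sign on the second. *)
    exists (block_mx 0 1%:M 0 0).
    rewrite !mulmx_block !(mulmx0, mul0mx, addr0, add0r, mulmx1, mul1mx).
    by rewrite add_block_mx !(addr0, add0r) subrr -scalar_mx_block.
  exists (block_mx H 0 0 (- H)).
  rewrite !mulmx_block !(mulmx0, mul0mx, addr0, add0r, mulmxN, mulNmx, opprK).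
  rewrite add_block_mx !addr0 eH mul_scalar_mx mul_mx_scalar subrr.
  by rewrite -scalar_mx_block.
Qed.

Lemma koszul_exists (hA : noetherian A) (b : ideal A) :
  exists N (D : 'M[A]_N) (j0 : 'I_N), koszul_mx b D j0.
Proof.
have [r [g hg]] := hA b.
have [|N [D [j0 [DD D0 Db DH]]]] := @koszul_seq b (codom g).
  by move=> _ /codomP[i ->]; apply: gens_mem hg.
exists N, D, j0; split=> // f /hg[c ->].
have hH i : exists H, D *m H + H *m D = (g i)%:M by apply: DH; apply: codom_f.
have [H eH] := choice hH.
exists (\sum_i c i *: H i); rewrite mulmx_sumr mulmx_suml -big_split /=.
rewrite raddf_sum; apply: eq_bigr => i _.
by rewrite -scalemxAr -scalemxAl -scalerDr eH scale_scalar_mx.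
Qed.

(** This is D tensored with V. *)
Definition mx_act N (D : 'M[A]_N) (V : lmodType A) (x : 'I_N -> V) (i : 'I_N) : V :=
  \sum_j D i j *: x j.

Section Action.
Variables (N : nat) (V : lmodType A).
Implicit Types (D H : 'M[A]_N) (x y : 'I_N -> V).

Lemma mx_act_mul D H x i : mx_act (D *m H) x i = mx_act D (mx_act H x) i.
Proof.
rewrite /mx_act; under eq_bigr do rewrite mxE scaler_suml.
rewrite exchange_big; apply: eq_bigr => k _; rewrite scaler_sumr.
by apply: eq_bigr => j _; rewrite scalerA.
Qed.

Lemma mx_actD D H x i : mx_act (D + H) x i = mx_act D x i + mx_act H x i.
Proof. by rewrite -big_split; apply: eq_bigr => j _; rewrite mxE scalerDl. Qed.

Lemma mx_act_scalar (f : A) x i : mx_act f%:M x i = f *: x i.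
Proof.
rewrite /mx_act (bigD1 i) //= mxE eqxx big1 ?addr0 // => j /negPf ji.
by rewrite mxE eq_sym ji scale0r.
Qed.

Lemma mx_actB D x y i :
  mx_act D (fun j => x j - y j) i = mx_act D x i - mx_act D y i.
Proof. by rewrite -sumrB; apply: eq_bigr => j _; rewrite scalerBr. Qed.

Lemma mx_act_sub D (B : submodule V) x i : (forall j, x j \in B) -> mx_act D x i \in B.
Proof. by move=> xB; apply: rpred_sum => j _; apply: rpredZ. Qed.

Lemma mx_act_lin (V' : lmodType A) (h : {linear V -> V'}) D x i :
  mx_act D (fun j => h (x j)) i = h (mx_act D x i).
Proof. by rewrite linear_sum; apply: eq_bigr => j _; rewrite linearZ. Qed.

End Action.

(** * Modules with exact Koszul complexes *)

Section Acyclic.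
Variables (b : ideal A) (N : nat) (D : 'M[A]_N) (j0 : 'I_N).
Hypothesis hD : koszul_mx b D j0.

Lemma mx_act_sq (V : lmodType A) (x : 'I_N -> V) i : mx_act D (mx_act D x) i = 0.
Proof.
case: hD => DD _ _ _; rewrite -mx_act_mul DD /mx_act big1 // => j _.
by rewrite mxE scale0r.
Qed.

(* The Koszul complex of V / B, in total form, is exact. *)
Definition acyclic (V : lmodType A) (B : submodule V) : Prop :=
  forall x : 'I_N -> V, (forall i, mx_act D x i \in B) ->
  exists y : 'I_N -> V, forall i, x i - mx_act D y i \in B.

(** One may assume that b kills x modulo [B]. Placed in coordinate [j0], x is then a cycle, as
    column [j0] has entries in b, hence a boundary; row [j0] of D being zero, x lies in [B]. *)
Lemma acyclic_torsion_free (hA : noetherian A) (V : lmodType A) (B : submodule V) x :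
  acyclic B ->
  (forall g : A, (g : A^o) \in b -> exists n, g ^+ n *: x \in B) -> x \in B.
Proof.
move=> aB hx; have [r [g hg]] := hA b; have [_ D0 Db _] := hD.
apply: (@gens_nilpotent_ind A V r g B (fun x => x \in B)) => //; last first.
  by move=> i; apply: hx; apply: gens_mem hg.
move=> {hx}x hx.
have bx f : (f : A^o) \in b -> f *: x \in B.
  move=> /hg[c ->]; rewrite scaler_suml; apply: rpred_sum => i _.
  rewrite -scalerA; apply: rpredZ; exact: hx.
have [|y hy] := aB (fun j => if j == j0 then x else 0).
  move=> i; rewrite /mx_act (bigD1 j0) //= eqxx big1 ?addr0.
    exact: bx (Db i).
  by move=> j /negPf->; rewrite scaler0.
have := hy j0; rewrite eqxx /mx_act big1 ?subr0 // => j _.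
by rewrite D0 scale0r.
Qed.

(** Multiplication by f is both bijective and null-homotopic on the Koszul complex. *)
Lemma acyclic_local (V : lmodType A) (f : A) :
  (f : A^o) \in b -> (forall x : V, f *: x = 0 -> x = 0) ->
  (forall x : V, exists y, f *: y = x) -> acyclic (zero_submod V).
Proof.
move=> fb finj fsurj x hx; have [_ _ _ DH] := hD; have [H eH] := DH f fb.
have [z hz] := choice (fun i => fsurj (x i)).
exists (mx_act H z) => i; rewrite zero_submodP.
have Dz k : mx_act D z k = 0.
  apply: finj; have := hx k; rewrite zero_submodP => /eqP <-.
  by rewrite scaler_sumr; apply: eq_bigr => j _; rewrite scalerA mulrC -scalerA hz.
rewrite -hz -mx_act_scalar -eH mx_actD !mx_act_mul addrAC subrr add0r.
by rewrite [X in X == 0]big1 // => j _; rewrite Dz scaler0.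
Qed.

(** The component x' of x in the complement of Gamma E is a cycle. The map A^N -> E that it defines
    factors through right multiplication by D, and the values of the factor on the unit vectors form
    a y with D y = x'. *)
Lemma acyclic_injective (hA : noetherian A) (E : lmodType A) :
  injective_module E -> acyclic (torsion b E).
Proof.
move=> hE x hx; have [r [rT rid]] := torsion_retraction hA b hE.
have [DD _ _ DH] := hD.
pose x' i := x i - r (x i).
have Dx' i : mx_act D x' i = 0.
  by rewrite mx_actB (mx_act_lin r) rid ?subrr.
have rx' i : r (x' i) = 0 by rewrite linearB (rid (r _)) ?subrr.
pose phi (a : 'rV[A]_N) := \sum_j a 0 j *: x' j.
have phi_lin : linear phi.
  move=> c u v; rewrite scaler_sumr -big_split /=; apply: eq_bigr => j _.
  by rewrite !mxE scalerDl scalerA.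
have phiD (a : 'rV[A]_N) : phi (a *m D) = 0.
  rewrite /phi; under eq_bigr do rewrite mxE scaler_suml.
  rewrite exchange_big big1 //= => i _.
  under eq_bigr do rewrite -scalerA.
  by rewrite -scaler_sumr [X in _ *: X](Dx' i) scaler0.
pose phil : {linear 'rV[A]_N -> E} :=
  HB.pack phi (GRing.isLinear.Build A _ _ _ phi phi_lin).
have [|psi hpsi] := @injective_factor A E hE 'rV[A]_N 'rV[A]_N (mulmxr D) phil.
  (* If a D = 0, the homotopies show that b kills [phi a], which is therefore torsion; but r also
     kills it, so it is 0. *)
  move=> a /= aD.
  have phiT : phi a \in torsion b E.
    apply/(torsionP b hA) => f fb; exists 1%N; rewrite expr1.
    have [H eH] := DH f fb.
    rewrite -[f *: phi a](linearZ_LR phil) /= -mul_mx_scalar -eH mulmxDr !mulmxA aD.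
    by rewrite mul0mx add0r phiD.
  by rewrite -(rid _ phiT) linear_sum big1 // => j _; rewrite linearZ_LR rx' scaler0.
exists (fun i => psi (delta_mx 0 i)) => i.
rewrite -[x i](subrK (r (x i))) -/(x' i) addrAC.
suff -> : mx_act D (fun j => psi (delta_mx 0 j)) i = x' i by rewrite subrr add0r.
rewrite (mx_act_lin psi).
have -> : mx_act D (fun j => delta_mx 0 j) i = delta_mx 0 i *m D :> 'rV_N.
  by rewrite -rowE [RHS]row_sum_delta /mx_act; apply: eq_bigr => j _; rewrite mxE.
rewrite [LHS](hpsi (delta_mx 0 i)) /= /phi (bigD1 i) //= mxE !eqxx scale1r big1 ?addr0 //.
by move=> j /negPf ji; rewrite mxE eqxx ji scale0r.
Qed.

Section Product.
Variables (V V' : lmodType A) (B : submodule V) (B' : submodule V').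

Fact prod_submod_closed :
  submod_closed [pred x : V * V' | (x.1 \in B) && (x.2 \in B')].
Proof.
split=> [|a x y]; rewrite !inE ?rpred0 //= => /andP[x1 x2] /andP[y1 y2].
by rewrite !submodule_lin.
Qed.
Definition prod_submod := Submodule prod_submod_closed.

Lemma prod_submodP (x : V * V') : (x \in prod_submod) = (x.1 \in B) && (x.2 \in B').
Proof. by rewrite inE. Qed.

Lemma acyclic_prod : acyclic B -> acyclic B' -> acyclic prod_submod.
Proof.
move=> aB aB' x hx.
have f1 y i : (mx_act D y i : V * V').1 = mx_act D (fun j => (y j).1) i.
  by rewrite -(mx_act_lin fst).
have f2 y i : (mx_act D y i : V * V').2 = mx_act D (fun j => (y j).2) i.
  by rewrite -(mx_act_lin snd).
have [|y hy] := aB (fun j => (x j).1).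
  by move=> i; rewrite -f1; have /andP[] := hx i.
have [|z hz] := aB' (fun j => (x j).2).
  by move=> i; rewrite -f2; have /andP[] := hx i.
exists (fun j => (y j, z j)) => i; rewrite prod_submodP /= f1 f2 /=.
by rewrite hy hz.
Qed.

End Product.

Section Cokernel.
Variables (V V' : lmodType A) (d : {linear V -> V'}).
Variables (K : submodule V) (B' : submodule V').

Fact im_add_submod_closed :
  submod_closed [pred y | `[< exists x, y - d x \in B' >]].
Proof.
split=> [|a x y]; rewrite !inE; first by exists 0; rewrite linear0 subr0 rpred0.
move=> [u hu] [v hv]; exists (a *: u + v).
by rewrite linearP opprD addrACA -scalerBr submodule_lin.
Qed.
Definition im_add_submod := Submodule im_add_submod_closed.

Lemma im_add_submodP y : y \in im_add_submod <-> exists x, y - d x \in B'.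
Proof. by split; rewrite inE. Qed.

(** Two out of three for 0 -> V / K -> V' / B' -> V' / (d V + B') -> 0, proved by a diagram
    chase. *)
Lemma acyclic_coker : (forall x, x \in K <-> d x \in B') ->
  acyclic K -> acyclic B' -> acyclic im_add_submod.
Proof.
move=> dK aK aB' x hx.
have [v hv] := choice (fun i => (im_add_submodP _).1 (hx i)).
have [|y hy] := aK v.
  move=> i; apply/dK; rewrite -(mx_act_lin d).
  have := mx_act_sub D i hv; rewrite mx_actB mx_act_sq sub0r.
  by rewrite rpredN.
have [|z hz] := aB' (fun i => x i - d (y i)).
  move=> i; rewrite mx_actB (mx_act_lin d).
  have -> : mx_act D x i - d (mx_act D y i) =
    (mx_act D x i - d (v i)) + d (v i - mx_act D y i).
    by rewrite linearB addrA subrK.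
  by rewrite rpredD //; apply/dK.
exists z => i; apply/im_add_submodP; exists (y i).
by rewrite addrAC.
Qed.

End Cokernel.

End Acyclic.
End Koszul.

(** * Comparison with local cohomology *)

Section SubquotIso.
Variable A : comPzRingType.

Lemma bijective_isomorphic (X Y : lmodType A) (h : {linear X -> Y}) :
  injective h -> (forall y, exists x, h x = y) -> isomorphic X Y.
Proof.
move=> hI /choice[k hk]; exists h; exists k => // x.
by apply: hI; rewrite hk.
Qed.

Lemma subquot_isomorphic (U V : lmodType A) (K B : submodule U) (K' B' : submodule V)
    (h : {linear U -> V}) :
  (forall x, x \in K -> h x \in K') ->
  (forall x, x \in K -> (h x \in B' <-> x \in B)) ->
  (forall y, y \in K' -> exists2 x, x \in K & y - h x \in B') ->
  isomorphic (subquot K B) (subquot K' B').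
Proof.
move=> hK hB hS.
pose hs (x : submod_type K) : submod_type K' := Sub (h (val x)) (hK _ (valP x)).
pose q (z : subquot K B) : subquot K' B' := quotmod_pi (trace_submod K' B') (hs (repr z)).
have qE x : q (quotmod_pi _ x) = quotmod_pi _ (hs x).
  apply/eqP; rewrite quotmod_eq inE /= -linearB; apply/hB.
    exact: (valP (repr (quotmod_pi (trace_submod K B) x) - x)).
  have : repr (quotmod_pi (trace_submod K B) x) - x \in trace_submod K B.
    by rewrite -quotmod_eq /quotmod_pi reprK.
  by rewrite inE.
have qlin : linear q.
  move=> a z t; have [x <-] := quotmod_surj z; have [y <-] := quotmod_surj t.
  rewrite -linearP !qE -linearP; congr quotmod_pi; apply: val_inj.
  exact: (linearP h).
apply: (@bijective_isomorphic _ _ (HB.pack q (GRing.isLinear.Build A _ _ _ q qlin))).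
  move=> z t /=; have [x <-] := quotmod_surj z; have [y <-] := quotmod_surj t.
  rewrite !qE => /eqP; rewrite quotmod_eq inE /= -linearB => /hB e.
  apply/eqP; rewrite quotmod_eq inE; apply: e; exact: (valP (x - y)).
move=> z /=; have [y <-] := quotmod_surj z.
have [x xK xy] := hS _ (valP y); exists (quotmod_pi _ (Sub x xK)).
by rewrite qE; apply/esym/eqP; rewrite quotmod_eq inE.
Qed.

End SubquotIso.

Section Compare.
Variables (A : comPzRingType) (hA : noetherian A) (b : ideal A).
Variables (C E : cochain_complex A) (aug : {linear C 0%N -> E 0%N}).
Hypothesis E_inj : forall i, injective_module (E i).
Hypothesis aug_inj : injective aug.
Hypothesis E_exact0 : forall x, cdiff E 0%N x = 0 <-> exists m, aug m = x.
Hypothesis E_exact : forall i x, cdiff E i.+1 x = 0 <-> exists y, cdiff E i y = x.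
Hypothesis C_local : forall i, exists f : A, [/\ (f : A^o) \in b,
  forall x : C i.+1, f *: x = 0 -> x = 0 & forall x : C i.+1, exists y, f *: y = x].
Hypothesis C_torsion : forall i x, cdiff C i x = 0 ->
  forall g : A, (g : A^o) \in b -> exists n, g ^+ n *: x \in boundaries C i.

Local Notation T i := (torsion b (E i)).

(** [phi] is the part still to be cancelled in degree i. The first condition allows it to be written
    as s d modulo torsion; the second passes the first on to the next degree. *)
Definition liftable i (phi : {linear C i -> E i}) : Prop :=
  (forall x, x \in boundaries C i -> phi x \in T i) /\
  (forall x, cdiff E i (phi x) = 0).

Lemma torsion_linear (X Y : lmodType A) (h : {linear X -> Y}) x :
  x \in torsion b X -> h x \in torsion b Y.
Proof. by move=> xT; exact: (torsion_map_proof h (Sub x xT)). Qed.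

(** The torsion-free component of [phi] factors through d: a cycle x has multiples g^n x that are
    boundaries, so [phi x] is torsion. *)
Lemma homotopy_step i (phi : {linear C i -> E i}) : liftable phi ->
  exists s : {linear C i.+1 -> E i}, forall x, phi x - s (cdiff C i x) \in T i.
Proof.
move=> [phiB _]; have [r [rT rid]] := torsion_retraction hA b (@E_inj i).
have [|s hs] := @injective_factor A _ (@E_inj i) _ _ (cdiff C i) (phi \- (r \o phi)).
  move=> x dx /=; rewrite rid ?subrr //; apply: (torsion_scale hA) => g gb.
  have [n ng] := C_torsion dx gb; exists n.
  by rewrite -linearZ; apply: phiB.
by exists s => x; rewrite hs /= opprB addrC subrK.
Qed.

(** Since d phi = 0, the new map sends the boundary d y to d (phi y - s (d y)), which is torsion. *)
Lemma liftable_next i (phi : {linear C i -> E i}) (s : {linear C i.+1 -> E i}) :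
  liftable phi -> (forall x, phi x - s (cdiff C i x) \in T i) ->
  liftable (\- (cdiff E i \o s)).
Proof.
move=> [_ dphi] hs; split=> [x|x] /=; last by rewrite linearN cdiffK oppr0.
rewrite inE => -[y <-]; have := torsion_linear (cdiff E i) (hs y).
by rewrite linearB dphi sub0r.
Qed.

Lemma homotopy_exists :
  exists (phi : forall i, {linear C i -> E i}) (s : forall i, {linear C i.+1 -> E i}),
  [/\ phi 0%N = aug, forall i x, phi i.+1 x = - cdiff E i (s i x),
      forall i x, phi i x - s i (cdiff C i x) \in T i
    & forall i x, cdiff E i (phi i x) = 0].
Proof.
have aug_lift : liftable (aug : {linear C 0%N -> E 0%N}).
  split=> x; last by apply/E_exact0; exists x.
  by rewrite zero_submodP => /eqP->; rewrite linear0 rpred0.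
(* The recursion carries the proof of liftability, which is needed to choose the next s. *)
pose st i := {phi : {linear C i -> E i} | liftable phi}.
pose sof i (p : st i) := projT1 (cid (homotopy_step (svalP p))).
have sofP i (p : st i) x : sval p x - sof i p (cdiff C i x) \in T i.
  exact: (projT2 (cid (homotopy_step (svalP p))) x).
pose fix stage i : st i := match i return st i with
  | 0%N => exist _ aug aug_lift
  | j.+1 => exist _ _ (liftable_next (svalP (stage j)) (sofP j (stage j))) end.
exists (fun i => sval (stage i)), (fun i => sof i (stage i)); split=> //.
by move=> i x; case: (svalP (stage i)) => _.
Qed.

(** * The mapping cone modulo torsion *)

Section Cone.
Variables (phi : forall i, {linear C i -> E i}) (s : forall i, {linear C i.+1 -> E i}).
Hypothesis phi0 : phi 0%N = aug.
Hypothesis phiS : forall i x, phi i.+1 x = - cdiff E i (s i x).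
Hypothesis phi_s : forall i x, phi i x - s i (cdiff C i x) \in T i.

(** No quotient by Gamma E is formed: the terms of the cone are [cone_obj n] modulo [cone_tors n],
    and [cone_bound n] is the preimage of its boundaries. *)
Definition cone_obj (n : nat) : lmodType A :=
  if n is k.+1 then [the lmodType A of (C k.+2 * E k)%type] else C 1%N.

Definition cone_d0 (c : C 1%N) : C 2 * E 0%N := (cdiff C 1 c, s 0 c).

Fact cone_d0_linear : linear cone_d0.
Proof. by move=> a x y; rewrite /cone_d0 !linearP. Qed.
HB.instance Definition _ := GRing.isLinear.Build A _ _ _ cone_d0 cone_d0_linear.

Definition cone_dS k (x : C k.+2 * E k) : C k.+3 * E k.+1 :=
  (cdiff C k.+2 x.1, s k.+1 x.1 + cdiff E k x.2).

Fact cone_dS_linear k : linear (@cone_dS k).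
Proof.
move=> a x y; rewrite /cone_dS !linearP /=; congr pair.
by rewrite addrACA -scalerDr.
Qed.
HB.instance Definition _ k :=
  GRing.isLinear.Build A _ _ _ (@cone_dS k) (@cone_dS_linear k).

Definition cone_diff n : {linear cone_obj n -> cone_obj n.+1} :=
  match n return {linear cone_obj n -> cone_obj n.+1} with
  | 0%N => cone_d0
  | k.+1 => @cone_dS k
  end.

Definition cone_tors n : submodule (cone_obj n) :=
  match n return submodule (cone_obj n) with
  | 0%N => zero_submod (C 1%N)
  | k.+1 => prod_submod (zero_submod (C k.+2)) (T k)
  end.

Definition cone_bound n : submodule (cone_obj n) :=
  match n return submodule (cone_obj n) with
  | 0%N => zero_submod (C 1%N)
  | k.+1 => im_add_submod (cone_diff k) (cone_tors k.+1)
  end.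

Lemma cone_boundP k (x : C k.+2 * E k) : x \in cone_bound k.+1 <->
  exists y, x.1 = (cone_diff k y).1 /\ x.2 - (cone_diff k y).2 \in T k.
Proof.
rewrite im_add_submodP; split=> -[y hy]; exists y; move: hy.
  by rewrite prod_submodP zero_submodP subr_eq0 => /andP[/eqP].
by rewrite prod_submodP zero_submodP subr_eq0 => -[-> ->]; rewrite eqxx.
Qed.

Lemma cone_diff_bound n x : x \in cone_bound n -> cone_diff n x \in cone_tors n.+1.
Proof.
case: n x => [|n] x.
  by rewrite zero_submodP => /eqP->; rewrite linear0 rpred0.
move=> /cone_boundP[y [x1 x2]]; rewrite prod_submodP zero_submodP /= {}x1.
have sd k c : s k.+1 (cdiff C k.+1 c) + cdiff E k (s k c) \in T k.+1.
  by rewrite -rpredN opprD -phiS addrC; apply: phi_s.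
have dx := torsion_linear (cdiff E n) x2.
case: n x y x2 dx => [|n] x y /= _.
  rewrite cdiffK eqxx linearB => dx; have := @rpredD _ (T 1%N) _ _ dx (sd 0%N y).
  by rewrite addrCA subrK.
rewrite cdiffK eqxx linearB linearD cdiffK addr0 => dx.
by have := @rpredD _ (T n.+2) _ _ dx (sd n.+1 y.1); rewrite addrCA subrK.
Qed.

Lemma cone_torsion n x : cone_diff n x \in cone_tors n.+1 ->
  forall g : A, (g : A^o) \in b -> exists k, g ^+ k *: x \in cone_bound n.
Proof.
case: n x => [|n] x; rewrite prod_submodP zero_submodP => /andP[/eqP dx sT] g gb.
  (* In degree 0, g^k x = d m, and [aug m] is torsion because s (d m) is; as [aug] is injective, a
     power of g kills m. *)
  have [k] := @C_torsion 1 x dx g gb; rewrite inE => -[m em].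
  have : aug m \in T 0.
    rewrite -phi0 -[phi _ m](subrK (s 0%N (cdiff C 0%N m))) rpredD ?phi_s //.
    by rewrite em linearZ rpredZ.
  move=> /(torsionP b hA)/(_ g gb)[l el]; exists (l + k)%N.
  rewrite zero_submodP exprD -scalerA -em -linearZ.
  suff -> : g ^+ l *: m = 0 by rewrite linear0.
  by apply: aug_inj; rewrite linearZ_LR el linear0.
(* In positive degree, g^k x.1 = d c, and g^k x.2 - s c becomes a cocycle of E after multiplication
   by a further power of g. *)
have [k] := @C_torsion n.+2 x.1 dx g gb; rewrite inE => -[c ec].
have eT : cdiff E n (g ^+ k *: x.2 - s n c) \in T n.+1.
  rewrite linearB -[X in _ + X]phiS linearZ_LR.
  have -> : g ^+ k *: cdiff E n x.2 + phi n.+1 c =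
      g ^+ k *: (s n.+1 x.1 + cdiff E n x.2) + (phi n.+1 c - s n.+1 (cdiff C n.+1 c)).
    by rewrite ec linearZ_LR scalerDr [X in _ = X + _]addrC addrACA subrr addr0.
  by rewrite rpredD ?rpredZ ?phi_s.
have [l] := (torsionP b hA _).1 eT g gb; rewrite -linearZ => de.
exists (l + k)%N; apply/(@cone_boundP n); rewrite exprD -scalerA /=.
case: n x c ec {eT dx sT} de => [|n] x c ec /=.
  move=> /E_exact0[m em].
  (* In the lowest degree the cocycle is [aug m], and s (d m) agrees with it modulo torsion. *)
  exists (g ^+ l *: c + cdiff C 0%N m) => /=; split.
    by rewrite linearD cdiffK addr0 (linearZ_LR (cdiff C 1)) ec.
  rewrite linearD opprD addrA (linearZ_LR (s 0%N)) -scalerBr -em -phi0; exact: phi_s.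
move=> /E_exact[e ee]; exists (g ^+ l *: c, e); split=> /=.
  by rewrite (linearZ_LR (cdiff C n.+2)) ec.
have -> : g ^+ l *: (g ^+ k *: x.2) - (s n.+1 (g ^+ l *: c) + cdiff E n e) = 0.
  by rewrite ee (linearZ_LR (s n.+1)) scalerBr [X in _ - X]addrC subrK subrr.
exact: (@rpred0 _ (T n.+1)).
Qed.

Section Exact.
Variables (N : nat) (D : 'M[A]_N) (j0 : 'I_N).
Hypothesis hD : koszul_mx b D j0.

Lemma acyclic_zero i : acyclic D (zero_submod (C i.+1)).
Proof.
have [f [fb finj fsurj]] := C_local i.
exact (acyclic_local hD fb finj fsurj).
Qed.

Lemma acyclic_cone_tors n : acyclic D (cone_tors n).
Proof.
case: n => [|n]; first exact: acyclic_zero.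
by apply: acyclic_prod; [apply: acyclic_zero | exact (acyclic_injective hD hA (@E_inj n))].
Qed.

(** By induction the term modulo [cone_bound n] has no torsion, while the cohomology in degree n is
    torsion. So the cone is exact there, and [acyclic_coker] applies to the induced injection. *)
Lemma acyclic_cone_bound n : acyclic D (cone_bound n).
Proof.
elim: n => [|n IH]; first exact: acyclic_zero.
refine (acyclic_coker hD (d := cone_diff n) (K := cone_bound n) _ IH
  (@acyclic_cone_tors n.+1)) => x.
split; first exact: cone_diff_bound.
by move=> dx; apply: (acyclic_torsion_free hD hA IH); apply: cone_torsion.
Qed.

End Exact.

Lemma cone_exact n x : cone_diff n x \in cone_tors n.+1 -> x \in cone_bound n.
Proof.
move=> dx; have [N [D [j0 hD]]] := koszul_exists hA b.
apply: (acyclic_torsion_free hD hA (@acyclic_cone_bound _ _ _ hD n)).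
exact: cone_torsion.
Qed.

End Cone.

Lemma compare_cohomology i :
  isomorphic (cohomology C i) (cohomology (torsion_complex b E) i).
Proof.
have [phi [s [phi0 phiS phi_s dphi]]] := homotopy_exists.
have cexact := cone_exact phi0 phiS phi_s.
(* The chain map C -> Gamma E is phi - s d; on cocycles of positive degree it is - d s. *)
pose beta j (x : C j) : submod_type (T j) := Sub (phi j x - s j (cdiff C j x)) (phi_s j x).
have beta_lin j : linear (@beta j).
  move=> a x y; apply: val_inj; rewrite /= (linearP (phi j)) (linearP (cdiff C j)).
  by rewrite (linearP (s j)) opprD addrACA -scalerBr.
pose bl j : {linear C j -> torsion_complex b E j} :=
  HB.pack (@beta j) (GRing.isLinear.Build A _ _ _ (@beta j) (@beta_lin j)).
have beta00 j : beta j 0 = 0 by exact: (linear0 (bl j)).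
have beta_d j x : cdiff (torsion_complex b E) j (beta j x) = beta j.+1 (cdiff C j x).
  apply: val_inj; rewrite /= linearB dphi phiS cdiffK linear0 subr0.
  by rewrite sub0r.
have beta_cycle j x : cdiff C j.+1 x = 0 -> val (beta j.+1 x) = - cdiff E j (s j x).
  by move=> dx; rewrite /= dx linear0 subr0 phiS.
have beta0 x : cdiff C 0%N x = 0 -> val (beta 0%N x) = aug x.
  by move=> dx; rewrite /= dx linear0 subr0 phi0.
have coneP0 (c : C 1%N) : cdiff C 1 c = 0 -> s 0%N c \in T 0 -> c = 0.
  move=> dc sc; apply/eqP; rewrite -zero_submodP; apply: (cexact 0%N c).
  by rewrite prod_submodP zero_submodP /= dc eqxx.
have coneP k (c : C k.+2) (e : E k) : cdiff C k.+2 c = 0 ->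
    s k.+1 c + cdiff E k e \in T k.+1 ->
    exists c' : C k.+1, c = cdiff C k.+1 c' /\
      exists2 t : E k, t \in T k & cdiff E k (e - s k c') = cdiff E k t.
  move=> dc sc; have /cone_boundP[y /=] : (c, e) \in cone_bound s k.+1.
    by apply: (cexact k.+1 (c, e)); rewrite prod_submodP zero_submodP /= dc eqxx.
  case: k c e {dc sc} y => [|k] c e y /= [-> h].
    by exists y; split=> //; exists (e - s 0%N y).
  exists y.1; split=> //; exists (e - (s k.+1 y.1 + cdiff E k y.2)) => //.
  by rewrite opprD addrA [in RHS]linearB cdiffK subr0.
apply: (@subquot_isomorphic A _ _ _ _ _ _ (bl i)).
- move=> x; rewrite !inE => /eqP dx; rewrite [bl i x]/(beta i x) beta_d dx.
  by rewrite beta00.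
- move=> x; rewrite inE => /eqP dx; rewrite [bl i x]/(beta i x).
  split; last first.
    case: i x dx => [|i] x dx.
      by rewrite !zero_submodP => /eqP->; apply/eqP; exact: beta00.
    by rewrite !inE => -[y <-]; exists (beta i y); rewrite beta_d.
  case: i x dx => [|i] x dx.
    rewrite !zero_submodP => /eqP e; apply/eqP; apply: aug_inj.
    by rewrite linear0 -(beta0 x dx) [beta 0%N x]e.
  (* Injectivity: if beta x = d t with t torsion, then s x + t is a cocycle of E, so it is [aug m]
     or d e. Exactness of the cone at x - d m, respectively at (x, -e), makes x a coboundary. *)
  rewrite !inE => -[t et].
  have : cdiff E i (s i x + val t) = 0.
    rewrite linearD -[X in _ + X]/(val (cdiff (torsion_complex b E) i t)) et.
    by rewrite beta_cycle // addrN.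
  case: i x dx t {et} => [|i] x dx t.
    move=> /E_exact0[m em]; exists m; apply/esym/eqP; rewrite -subr_eq0; apply/eqP.
    apply: coneP0; first by rewrite linearB dx cdiffK subrr.
    have -> : s 0%N (x - cdiff C 0%N m) = (phi 0%N m - s 0%N (cdiff C 0%N m)) - val t.
      by rewrite linearB phi0 em addrAC addrK.
    rewrite rpredB ?phi_s //; exact: valP t.
  move=> /E_exact[e ee]; have [|c [-> _]] := coneP i x (- e) dx.
    by rewrite linearN ee opprD addrA subrr sub0r rpredN; exact: valP t.
  by exists c.
- move=> y; rewrite inE => /eqP dy.
  have {}dy : cdiff E i (val y) = 0.
    by rewrite -[LHS]/(val (cdiff (torsion_complex b E) i y)) dy.
  case: i y dy => [|i] y dy.
    have [m em] := (E_exact0 _).1 dy.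
    have dm : cdiff C 0%N m = 0.
      apply: coneP0; first by rewrite cdiffK.
      have : phi 0%N m - s 0%N (cdiff C 0%N m) \in T 0 by apply: phi_s.
      rewrite phi0 em -rpredN opprB => h.
      by rewrite -[s _ _](subrK (val y)) rpredD //; exact: valP y.
    exists m; first by rewrite inE dm.
    rewrite zero_submodP subr_eq0; apply/eqP; apply: val_inj.
    by rewrite [RHS]beta0.
  (* Surjectivity: with y = d e, the pair (0, e) is a cocycle of the cone modulo torsion. This gives
     a cocycle c and a torsion t with y = d (s c) + d t, so -c maps to y - d t. *)
  have [e ee] := (E_exact _).1 dy.
  have [||c [/esym dc [t tT et]]] := coneP i 0 e.
  - by rewrite linear0.
  - by rewrite linear0 add0r ee; exact: valP y.
  have dNc : cdiff C i.+1 (- c) = 0 by rewrite linearN dc oppr0.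
  exists (- c); first by rewrite inE dNc.
  rewrite inE; exists (Sub t tT); apply: val_inj.
  rewrite -[LHS]/(cdiff E i t) -[RHS]/(val y - val (beta i.+1 (- c))) beta_cycle //.
  by rewrite -et linearB ee (linearN (s i)) (linearN (cdiff E i)) opprK.
Qed.

End Compare.

(** * Filter-regular sequences *)

Section PowerSums.
Variables (A : comPzRingType) (M : lmodType A).

Definition pow_sum (h : nat -> A) (n : nat) (m : M) : Prop :=
  exists x : nat -> M, m = \sum_(j < n) h j *: x j.

Lemma pow_sumP (h : nat -> A) n k (c : 'I_n -> A) (m : M) : (k <= n)%N ->
  (forall j : 'I_n, c j = h j) ->
  m \in sum_submod M (fun j : 'I_n => (j < k)%N) c <-> pow_sum h k m.
Proof.
move=> kn ch; split=> [/sum_submodP[x ->]|[x ->]].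
  pose y (j : nat) := if insub j is Some i then x i else 0.
  exists y; rewrite (big_ord_widen _ (fun j => h j *: y j) kn).
  by apply: eq_bigr => j _; rewrite /y valK ch.
apply/sum_submodP; exists (fun j : 'I_n => x j).
rewrite (big_ord_widen _ (fun j => h j *: x j) kn).
by apply: eq_bigr => j _; rewrite ch.
Qed.

Lemma eq_pow_sum (h h' : nat -> A) n m :
  (forall j, (j < n)%N -> h j = h' j) -> pow_sum h n m -> pow_sum h' n m.
Proof.
by move=> e [x ->]; exists x; apply: eq_bigr => j _; rewrite e.
Qed.

End PowerSums.

Section FilterRegular.
Variables (A : comPzRingType) (M : lmodType A).

(** Otherwise (N : m) misses all powers of g, so it lies in a prime p without g. The class of m
    survives in the localization at p, so p is in the support and contains b, hence g. *)
Lemma filter_regular_torsion (b : ideal A) (f : nat -> A) (n : nat) (g : A) (m : M) :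
  filter_regular_inf b M f -> (g : A^o) \in b ->
  pow_sum f n (f n *: m) -> exists k, pow_sum f n (g ^+ k *: m).
Proof.
move=> hf gb hm.
have := hf n.+1 ord_max; set N := sum_submod M _ _ => /= hN.
have NP x : x \in N <-> pow_sum f n x by apply: pow_sumP => //; apply: leqnSn.
clearbody N; apply: contrapT => hk.
have cJ : submod_closed [pred a : A^o | (a : A) *: m \in N].
  split=> [|a y z]; rewrite !inE ?scale0r ?rpred0 // => yN zN.
  by rewrite scalerDl -scalerA submodule_lin.
have [|p [pp Jp gp]] := @prime_avoiding A (Submodule cJ) g.
  by move=> k; apply/negP; rewrite inE => /NP ?; apply: hk; exists k.
case/negP: gp; apply: (hN p) => //; split=> //.
have mc : m \in colon_submod N (f n) by rewrite inE; apply/NP.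
exists (quotmod_pi _ (Sub m mc)); exists 1; first by case: pp.
case=> u up; rewrite /= scale1r scaler0 subr0 -linearZ => /eqP.
rewrite -(linear0 (quotmod_pi _)) quotmod_eq subr0 inE /= => um.
by case/negP: up; apply: Jp; rewrite inE.
Qed.

(** * Weakly regular sequences after inverting one element *)

Section Saturated.
Variable g : A.
Implicit Types (P : submodule M) (x y : A) (s : seq A).

(** Equivalently, M / P embeds in its localization at the powers of g. *)
Definition saturated P := forall m : M, g *: m \in P -> m \in P.

Lemma saturated_exp P n m : saturated P -> g ^+ n *: m \in P -> m \in P.
Proof.
move=> sP; elim: n => [|n IH]; first by rewrite expr0 scale1r.
by rewrite exprS -scalerA => /sP/IH.
Qed.

Fact adj_submod_closed P x :
  submod_closed [pred m | `[< exists n m', g ^+ n *: m - x *: m' \in P >]].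
Proof.
split=> [|c m m']; rewrite !inE.
  by exists 0%N, 0; rewrite !scaler0 subrr rpred0.
move=> [n [u hu]] [k [v hv]]; exists (n + k)%N, ((c * g ^+ k) *: u + g ^+ n *: v).
have -> : g ^+ (n + k) *: (c *: m + m') - x *: ((c * g ^+ k) *: u + g ^+ n *: v) =
   (c * g ^+ k) *: (g ^+ n *: m - x *: u) + g ^+ n *: (g ^+ k *: m' - x *: v).
  rewrite !scalerDr !scalerN !scalerA opprD addrACA.
  by congr (_ *: _ - _ *: _ + (_ *: _ - _ *: _)); rewrite ?exprD; ring.
by rewrite submodule_lin ?rpredZ.
Qed.

(* the preimage in M of x (M / P)_g, for the localization at the powers of g *)
Definition adj P x := Submodule (adj_submod_closed P x).

Lemma adjP P x m : m \in adj P x <-> exists n m', g ^+ n *: m - x *: m' \in P.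
Proof. by split; rewrite inE. Qed.

Lemma adj_saturated P x : saturated (adj P x).
Proof.
move=> m /adjP[n [m' h]]; apply/adjP; exists n.+1, m'.
by rewrite exprSr -scalerA.
Qed.

Lemma adj_sub P x : {subset P <= adj P x}.
Proof.
move=> m mP; apply/adjP; exists 0%N, 0.
by rewrite expr0 scale1r scaler0 subr0.
Qed.

Lemma adj_ext P P' x : P =i P' -> adj P x =i adj P' x.
Proof.
by move=> e m; apply/idP/idP => /adjP[n [m' h]]; apply/adjP; exists n, m'; rewrite ?e // -e.
Qed.

Lemma adj2P P x y m : m \in adj (adj P x) y <->
  exists n u v, g ^+ n *: m - x *: u - y *: v \in P.
Proof.
split=> [/adjP[n [v /adjP[k [u h]]]]|[n [u [v h]]]].
  exists (k + n)%N, u, (g ^+ k *: v); move: h.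
  by rewrite scalerBr !scalerA exprD [g ^+ k * y]mulrC addrAC.
apply/adjP; exists n, v; apply/adjP; exists 0%N, u.
by rewrite expr0 scale1r addrAC.
Qed.

Lemma adjC P x y : adj (adj P x) y =i adj (adj P y) x.
Proof.
by move=> m; apply/idP/idP => /adj2P[n [u [v h]]]; apply/adj2P; exists n, v, u;
  rewrite addrAC.
Qed.

(* s is a weakly regular sequence on the localization (M / P)_g. *)
Fixpoint reg P s : Prop :=
  if s is x :: s' then
    (forall m : M, x *: m \in P -> m \in P) /\ reg (adj P x) s'
  else True.

Lemma reg_ext s P P' : P =i P' -> reg P s -> reg P' s.
Proof.
elim: s P P' => [|x s IH] P P' e //= [h r]; split.
  by move=> m; rewrite -!e; apply: h.
exact: IH (adj_ext x e) r.
Qed.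

Lemma reg_top s P : (forall m, m \in P) -> reg P s.
Proof.
elim: s P => [|x s IH] P h //=; split=> //.
by apply: IH => m; apply: adj_sub.
Qed.

(* Regularity passes to the middle of the exact sequence
   0 -> M / P1 -y-> M / P2 -> M / (P2 + y M) -> 0, localized at g. *)
Lemma reg_extension s P1 P2 y : saturated P2 ->
  (forall l : M, y *: l \in P2 <-> l \in P1) ->
  reg P1 s -> reg (adj P2 y) s -> reg P2 s.
Proof.
elim: s P1 P2 => [|x s IH] P1 P2 //= s2 yP [r1 R1] [r3 R3]; split.
  move=> m xm; have /r3/adjP[n [l h]] : x *: m \in adj P2 y by apply: adj_sub.
  suff lP : l \in P1.
    by apply: (@saturated_exp P2 n m s2); rewrite -[_ *: m](subrK (y *: l)) rpredD //; apply/yP.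
  apply: r1; apply/yP; rewrite scalerA mulrC -scalerA.
  rewrite -[y *: l](subKr (g ^+ n *: m)) scalerBr; apply: rpredB; last exact: rpredZ.
  by rewrite scalerA mulrC -scalerA rpredZ.
apply: (IH (adj P1 x)) (R1) _; first exact: adj_saturated; last first.
  exact: reg_ext (adjC P2 y x) R3.
move=> l; split=> /adjP[n [m h]]; last first.
  apply/adjP; exists n, (y *: m); move/yP: h; rewrite scalerBr !scalerA.
  by rewrite [y * x]mulrC [y * g ^+ n]mulrC.
have /r3/adjP[k [l' h']] : x *: m \in adj P2 y.
  apply/adjP; exists 0%N, (g ^+ n *: l); rewrite expr0 scale1r.
  by rewrite -rpredN opprB scalerA mulrC -scalerA.
apply/adjP; exists (k + n)%N, l'; apply/yP.
have -> : y *: (g ^+ (k + n) *: l - x *: l') =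
  g ^+ k *: (g ^+ n *: (y *: l) - x *: m) + x *: (g ^+ k *: m - y *: l').
  rewrite !scalerBr !scalerA exprD [x * g ^+ k]mulrC addrA subrK.
  by congr (_ *: _ - _ *: _); ring.
by rewrite rpredD ?rpredZ.
Qed.

(** Induction on k along 0 -> M / x^k M -> M / x^(k+1) M -> M / x M -> 0, taken modulo [P] and
    localized at g; the first map is multiplication by x. *)
Lemma reg_adj_exp P x s k : saturated P -> reg P (x :: s) -> reg (adj P (x ^+ k)) s.
Proof.
move=> sP /= [r R]; elim: k => [|k IH].
  apply: reg_top => m; apply/adjP; exists 0%N, m.
  by rewrite !expr0 subrr rpred0.
apply: (@reg_extension s (adj P (x ^+ k)) _ x (@adj_saturated _ _) _ IH).
  move=> l; split=> /adjP[n [m h]]; apply/adjP; exists n, m.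
    apply: r; move: h; rewrite scalerBr !scalerA exprS.
    by rewrite [x * g ^+ n]mulrC.
  rewrite exprS -scalerA [g ^+ n *: _]scalerA mulrC -scalerA -scalerBr.
  exact: rpredZ.
apply: reg_ext R => m; apply/idP/idP.
  move=> /adjP[n [v h]]; apply/adj2P; exists n, 0, v.
  by rewrite scaler0 subr0.
move=> /adj2P[n [u [v h]]]; apply/adjP; exists n, (x ^+ k *: u + v).
by rewrite scalerDr scalerA -exprS opprD addrA.
Qed.

Lemma reg_exp (s : seq (A * nat)) P : saturated P ->
  reg P [seq p.1 | p <- s] -> reg P [seq p.1 ^+ p.2 | p <- s].
Proof.
elim: s P => [|[x k] s IH] P sP //= [r R]; split.
  elim: k => [|k IHk] m; first by rewrite expr0 scale1r.
  by rewrite exprS -scalerA => /r/IHk.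
apply: IH; first exact: adj_saturated.
exact: (reg_adj_exp k sP).
Qed.

Lemma reg_rcons P s x : reg P (rcons s x) <->
  reg P s /\ forall m, x *: m \in foldl adj P s -> m \in foldl adj P s.
Proof.
elim: s P => [|y s IH] P /=; first by split=> [[]|[]].
split; first by move=> [h /IH[]].
by move=> [[h R] hx]; split=> //; apply/IH.
Qed.

(** The kernel of M -> M_g, which is saturated, as 0 need not be. *)
Definition adj0 := adj (zero_submod M) 0.

Lemma fold_adjP (h : nat -> A) n m :
  m \in foldl adj adj0 (mkseq h n) <-> exists k, pow_sum h n (g ^+ k *: m).
Proof.
elim: n m => [|n IH] m.
  split=> [/adjP[k [m' ]]|[k [x]]].
    rewrite scale0r subr0 zero_submodP => /eqP e; exists k, (fun=> 0).
    by rewrite big_ord0.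
  rewrite big_ord0 => e; apply/adjP; exists k, 0.
  by rewrite scale0r subr0 zero_submodP e.
rewrite mkseqS foldl_rcons; split.
  move=> /adjP[k [m' /IH[l [x e]]]]; exists (l + k)%N.
  exists (fun j => if j == n then g ^+ l *: m' else x j).
  rewrite big_ord_recr /= eqxx; move/eqP: e; rewrite scalerBr subr_eq => /eqP e.
  rewrite exprD -scalerA e scalerA mulrC -scalerA; congr (_ + _).
  by apply: eq_bigr => j _; rewrite ltn_eqF.
move=> [k [x]]; rewrite big_ord_recr /= => e; apply/adjP; exists k, (x n).
by apply/IH; exists 0%N, x; rewrite expr0 scale1r e addrK.
Qed.

End Saturated.

(** For g in b the sequence f is weakly regular on M_g, and weak regularity passes to powers. *)
Lemma filter_regular_powers (b : ideal A) (f : nat -> A) (a : nat -> nat) n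
    (g : A) (m : M) :
  filter_regular_inf b M f -> (g : A^o) \in b ->
  pow_sum (fun j => f j ^+ a j) n (f n ^+ a n *: m) ->
  exists k, pow_sum (fun j => f j ^+ a j) n (g ^+ k *: m).
Proof.
move=> hf gb hm.
have R k : reg g (adj0 g) (mkseq f k).
  elim: k => [|k IH] //; rewrite mkseqS; apply/reg_rcons; split=> // x.
  move=> /fold_adjP[l h]; apply/fold_adjP.
  have h' : pow_sum f k (f k *: (g ^+ l *: x)) by rewrite scalerA mulrC -scalerA.
  have [r hr] := filter_regular_torsion hf gb h'; exists (r + l)%N.
  by rewrite exprD -scalerA.
have := @reg_exp g (mkseq (fun j => (f j, a j)) n.+1) _ (@adj_saturated g _ _).
rewrite -!map_comp => /(_ _ _ (R n.+1)); rewrite -/(mkseq _ _) mkseqS.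
move=> /reg_rcons[_ h]; apply/fold_adjP; apply: h; apply/fold_adjP.
by exists 0%N; rewrite expr0 scale1r.
Qed.

End FilterRegular.

(** * The complex of generalized fractions *)

Section GenFracComplex.
Variables (A : comPzRingType) (f : nat -> A) (M : lmodType A).

(** Exponents form one sequence over all naturals, so that the same [a] serves every length n. *)
Definition powrow (n : nat) (a : nat -> nat) : 'rV[A]_n := \row_(j < n) f j ^+ a j.

Definition den (n : nat) (a : nat -> nat) : power_tri f n :=
  exist _ (powrow n a)
    (mem_set (ex_intro _ (fun j : 'I_n => a j) erefl : tri_set (power_tri f n) _)).

Definition pow_prod (n : nat) (c : nat -> nat) : A := \prod_(j < n) f j ^+ c j.

Lemma powersP n (u : 'rV[A]_n) : powers f u -> exists a, u = powrow n a.
Proof.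
move=> [alpha ->]; exists (fun j => if insub j is Some i then alpha i else 0%N).
by apply/rowP => j; rewrite !mxE valK.
Qed.

Lemma den_surj n (u : power_tri f n) : exists a, u = den n a.
Proof.
have [a e] := powersP (set_valP u); exists a; exact: val_inj.
Qed.

Lemma frac_den_surj n (q : genfrac (power_tri f n) M) :
  exists m a, q = frac m (den n a).
Proof.
by have [m [u ->]] := frac_surj q; have [a ->] := den_surj u; exists m, a.
Qed.

Lemma eq_den n a a' : (forall j, (j < n)%N -> a j = a' j) -> den n a = den n a'.
Proof. by move=> e; apply: val_inj; apply/rowP => j; rewrite !mxE e. Qed.

Lemma frac_den_lift n m a c :
  frac m (den n a) = frac (pow_prod n c *: m) (den n (fun j => a j + c j)%N)
    :> genfrac (power_tri f n) M.
Proof.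
have t : transfers (diag_mx (powrow n c)) (val (den n a))
    (val (den n (fun j => a j + c j)%N)).
  have -> : val (den n (fun j => a j + c j)%N) =
      \row_j (powrow n c 0 j * powrow n a 0 j).
    by apply/rowP => j; rewrite !mxE exprD mulrC.
  exact: transfers_diag.
rewrite (frac_transfer m t) det_diag; congr (frac (_ *: _) _).
by apply: eq_bigr => j _; rewrite mxE.
Qed.

Lemma psum_powP n a m :
  m \in psum M (powrow n a) <-> pow_sum (fun j => f j ^+ a j) n.-1 m.
Proof. by apply: pow_sumP; [apply: leq_pred | move=> j; rewrite mxE]. Qed.

Lemma frac_den_sub n m m' a : pow_sum (fun j => f j ^+ a j) n.-1 (m - m') ->
  frac m (den n a) = frac m' (den n a) :> genfrac (power_tri f n) M.
Proof.
move=> /psum_powP h; apply/frac_eq_same.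
by apply: psum_vanishes => //; exact: set_valP (den n a).
Qed.

(* The matrix witnessing m / u = 0 may be taken diagonal: two transfer matrices
   with the same source and target have determinants that agree modulo the
   relevant submodule, after enlarging the denominator. *)
Lemma frac_den_eq0 n m a : frac m (den n a) = 0 :> genfrac (power_tri f n) M ->
  exists c, pow_sum (fun j => f j ^+ (a j + c j)) n.-1 (pow_prod n c *: m).
Proof.
move=> e; have : frac m (den n a) = frac 0 (den n a) :> genfrac (power_tri f n) M.
  by rewrite e; apply: gf_zeroE.
move=> /frac_eq_same; rewrite subr0 => -[w' [R [/powersP[c ->] tR hR]]].
set u := val (den n a) in tR; set v := powrow n c in tR hR.
pose w : 'rV[A]_n := \row_j (u 0 j * v 0 j).
have t1 : transfers (diag_mx u) v w by exact: transfers_diag.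
have tK : transfers (diag_mx v) u w.
  have -> : w = \row_j (v 0 j * u 0 j) by apply/rowP => j; rewrite !mxE mulrC.
  exact: transfers_diag.
have h1 := det_psum t1 hR; have tH := transfers_comp tR t1.
have h2 := det_psum (transfers_diag w w) h1.
have h3 := det_diff_psum m tH tK.
have h4 := rpredB h2 h3.
(* The final denominator is w^2 with w = u v, that is, u times u v^2; the last factor has exponents
   a + 2 c. *)
exists (fun j => a j + (c j + c j))%N; move: h4.
rewrite !scalerA det_mulmx -scalerBl -mulrA -mulrBr subKr.
have -> : \row_j (w 0 j * w 0 j) = powrow n (fun j => a j + (a j + (c j + c j)))%N.
  by apply/rowP => j; rewrite !mxE !exprD; ring.
move=> /psum_powP; congr (pow_sum _ _ (_ *: _)).
rewrite !det_diag -big_split; apply: eq_bigr => j _.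
by rewrite /= !mxE !exprD mulrA.
Qed.

(** The exponent 0 at n encodes the entry 1 appended by the differential. *)
Definition trunc n (a : nat -> nat) (j : nat) : nat := if (j < n)%N then a j else 0%N.

Definition gf_elt (i : nat) (m : M) (a : nat -> nat) : gf_obj f M i :=
  match i return gf_obj f M i with
  | 0%N => m
  | k.+1 => frac m (den k.+1 a)
  end.

Lemma gf_elt_surj i (q : gf_obj f M i) : exists m a, q = gf_elt i m a.
Proof.
case: i q => [|i] q; first by exists q, (fun=> 0%N).
exact: frac_den_surj.
Qed.

Lemma gf_diff_elt i m a : gf_diff f M i (gf_elt i m a) = gf_elt i.+1 m (trunc i a).
Proof.
case: i => [|i] /=.
  by congr frac; apply: val_inj; apply/rowP => j; rewrite !mxE.
rewrite gf_appendE; congr frac; apply: val_inj; apply/rowP => j.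
rewrite !mxE /trunc; case: unliftP => [k ->|->] /=.
  by rewrite mxE bump_max ltn_ord.
by rewrite ltnn expr0.
Qed.

Lemma pow_prod_delta i k : pow_prod i.+1 (fun j => if j == i then k else 0%N) = f i ^+ k.
Proof.
rewrite /pow_prod big_ord_recr /= eqxx big1 ?mul1r // => j _.
by rewrite ltn_eqF // expr0.
Qed.

(** The last entry of a denominator is absent from the submodule that decides vanishing, so the
    factor f_i can be moved into the last exponent of the witness. *)
Lemma gf_local_inj i (q : gf_obj f M i.+1) : f i *: q = 0 -> q = 0.
Proof.
have [m [a ->]] := frac_den_surj q; rewrite /= fracZ => /frac_den_eq0[c hc].
pose c' j := if j == i then (c j).+1 else c j.
rewrite (frac_den_lift i.+1 m a c').
transitivity (frac 0 (den i.+1 (fun j => a j + c' j)%N) : genfrac (power_tri f i.+1) M).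
  apply: frac_den_sub; rewrite subr0.
  have -> : pow_prod i.+1 c' = pow_prod i.+1 c * f i.
    rewrite /pow_prod !big_ord_recr /= /c' eqxx exprSr mulrA.
    by congr (_ * _ * _); apply: eq_bigr => j _; rewrite ltn_eqF.
  rewrite -scalerA; apply: eq_pow_sum hc => j ji.
  by rewrite /c' ltn_eqF.
exact/esym/gf_zeroE.
Qed.

Lemma gf_local_surj i (q : gf_obj f M i.+1) : exists y, f i *: y = q.
Proof.
have [m [a ->]] := frac_den_surj q.
pose c j := if j == i then 1%N else 0%N.
exists (frac m (den i.+1 (fun j => a j + c j)%N)).
by rewrite fracZ (frac_den_lift i.+1 m a c) pow_prod_delta expr1.
Qed.

(** Vanishing of m/(u, 1) puts a power of f_i times a multiple of m into the sum of the f_j^(a_j +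
    c_j) M with j < i. Filter regularity of the powers replaces that power of f_i by one of g. Over
    the denominator all terms of the resulting sum but the last vanish, and the last one is a
    coboundary. *)
Lemma gf_torsion (b : ideal A) (hf : filter_regular_inf b M f) i
    (q : genfrac_complex f M i) (g : A) :
  cdiff (genfrac_complex f M) i q = 0 -> (g : A^o) \in b ->
  exists n, g ^+ n *: q \in boundaries (genfrac_complex f M) i.
Proof.
have [m [a ->]] := gf_elt_surj q; rewrite [cdiff _ _ _]gf_diff_elt => dq gb.
have [c] := frac_den_eq0 dq.
rewrite /pow_prod big_ord_recr /= mulrC -scalerA => hc.
have {}hc : pow_sum (fun j => f j ^+ (trunc i a j + c j)) i
    (f i ^+ (trunc i a i + c i) *: (pow_prod i c *: m)).
  by rewrite /trunc ltnn add0n.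
have [n [x hx]] := filter_regular_powers (a := fun j => (trunc i a j + c j)%N) hf gb hc.
exists n; case: i q a dq c hc hx => [|i] q a dq c _.
  by rewrite /pow_prod !big_ord0 scale1r => hx; rewrite zero_submodP /= hx.
rewrite big_ord_recr /= => hx.
(* The last term f_i^(a_i + c_i) x_i cancels against the last entry of its denominator, leaving 1
   there: this is the differential of the given element. The exponent sequence [e] below undoes the
   cancellation. *)
rewrite inE; exists (gf_elt i (x i) (fun j => a j + c j)%N).
rewrite [LHS]gf_diff_elt /= fracZ (frac_den_lift _ _ a c) scalerA mulrC -scalerA hx.
pose e j := if j == i then (a i + c i)%N else 0%N.
rewrite (frac_den_lift _ _ _ e) (pow_prod_delta i (a i + c i)).
set d := den _ _; have -> : d = den i.+1 (fun j => a j + c j)%N.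
  apply: eq_den => j; rewrite ltnS leq_eqVlt /trunc /e.
  by case: eqP => [->|_] /= => [|->]; rewrite ?ltnn ?addn0.
apply: frac_den_sub; rewrite /trunc ltnSn opprD addrCA subrr addr0.
exists (fun j => - x j); rewrite -sumrN; apply: eq_bigr => j _.
by rewrite scalerN ltnS ltnW.
Qed.

End GenFracComplex.

Theorem corollary5p7 (A : comPzRingType) (hA : noetherian A) (b : ideal A)
    (M : lmodType A) (f : nat -> A)
    (hfr : filter_regular_inf b M f) (hfb : forall t : nat, f t \in b)
    (E : injective_resolution M) (i : nat) :
  isomorphic (cohomology (genfrac_complex f M) i) (local_cohomology b E i).
Proof.
apply: (@compare_cohomology A hA b (genfrac_complex f M) E (res_aug E)).
- exact: res_inj.
- exact: res_aug_inj.
- exact: res_exact0.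
- exact: res_exact.
- move=> j; exists (f j); split; first exact: hfb.
    exact: gf_local_inj.
  exact: gf_local_surj.
- by move=> j x dx g gb; apply: gf_torsion.
Qed.
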